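(* Let $(a,D[a])$ be a local Dirichlet form on $L^2(X,m(dx))$ that satisfies (a1) and (a2), and let $L$ be the associated non-negative self-adjoint operator. Let $A>0$, let $1<p<\infty$ and let $q=\frac{p}{p-1}$ be its conjugate exponent. Then there exists an extremal pair $(\tilde u,\tilde V)$, i.e. $\tilde V\in B_A$ with $\sup\{\lambda_1(V):V\in B_A\}=\lambda_1(\tilde V)<+\infty$ and $\tilde u$ a non-trivial solution of the eigenvalue problem with potential $\tilde V$ and eigenvalue $\lambda_1(\tilde V)$, with the following properties. The potential $\tilde V$ is the unique maximizer of $V\mapsto\lambda_1(V)$ in $B_A=\{f\in L^p(X,m(dx)):\|f\|_p\le A\}$. The function $\tilde u$ is a non-negative minimizer of the functional $J$ on $\{u \in D[a] : u\neq 0\}$, and is also the first eigenfunction of $$L\tilde u+\tilde V\tilde u=\lambda_1(\tilde V)\,\tilde u\ \text{ in }X,\qquad \tilde u\in D[a],$$ where $$\tilde V=\Big(A\,\|\tilde u^2\|_q^{1-q}\Big)\,\tilde u^{2(q-1)},$$ and $\lambda_1(\tilde V)$ is the maximal first eigenvalue, with $$\lambda_1(\tilde V)=J(\tilde u)=R_{\tilde V}(\tilde u).$$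
   Context: $X$ is a locally compact separable Hausdorff space and $m(dx)$ is a (non-negative) Radon measure on $X$ with support equal to $X$ (finite on compact sets, strictly positive on non-empty open sets). $\|\cdot\|_p$ is the norm of the real space $L^p(X,m(dx))$, $1\le p\le\infty$, and $(u,v)$ is the inner product of $L^2(X,m(dx))$. A Dirichlet form $(a,D[a])$ on $L^2(X,m(dx))$ is a symmetric non-negative bilinear form $a[u,v]$ defined on a dense subspace $D[a]$ of $L^2(X,m(dx))$, such that $D[a]$ is a Hilbert space under the intrinsic norm $(a[u,u]+(u,u))^{1/2}$, and which is Markovian: if $u\in D[a]$ then $v=\min\{1,\max\{u,0\}\}\in D[a]$ and $a[v,v]\le a[u,u]$. The form is local if $a[u,v]=0$ whenever $u,v\in D[a]$ have disjoint supports. Its generator is the non-negative self-adjoint operator $L$ with domain dense in $D[a]$ such that $a[u,v]=(Lu,v)$ for $u\in D[L]$, $v\in D[a]$. (a1) The embedding $D[a]\hookrightarrow L^2(X,m(dx))$ is compact. (a2) For every compact set $K$ and each relatively compact open set $G\subset X$ with $K\subset G$, there exists $u\in D[a]$ with $u=1$ on $K$ and $u=0$ on $X\setminus G$. $B_A=\{f:\|f\|_p\le A\}$. For $V\in B_A$, the equation $Lu+Vu=\lambda u$ in $X$, $u\in D[a]$, means $a[u,w]+\int_X Vuw\,m(dx)=\lambda\int_X uw\,m(dx)$ for every $w\in D[a]$. The Rayleigh quotient is $$R_V(u)=\frac{a[u,u]+\int_X Vu^2\,m(dx)}{\int_X u^2\,m(dx)},\qquad u\in D[a],\ u\ne0,$$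 and the first eigenvalue is $\lambda_1(V)=\inf\{R_V(u):u\in D[a],\,u\ne0\}$ (infimum over those $u$ for which the quotient is well defined in $(-\infty,+\infty]$ or $[-\infty,+\infty)$). The functional $J$ is $$J(u)=\frac{a[u,u]+A\|u\|_{2q}^2}{\|u\|_2^2},\qquad u\in D[a],\ u\neq0,$$ with value $+\infty$ if $u\notin L^{2q}(X,m(dx))$. *)

(* Defs.v *)
(* Elements of L^p spaces are represented by measurable functions; domains of *)
(* forms are sets of functions closed under a.e. equality, and relations      *)
(* between elements of L^p are understood a.e.                                *)
From HB Require Import structures.
From mathcomp Require Import all_boot all_order all_algebra.
From mathcomp Require Import all_classical all_reals all_analysis.

Set Implicit Arguments.
Unset Strict Implicit.
Unset Printing Implicit Defensive.
Import Order.TTheory GRing.Theory Num.Theory.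
Import numFieldNormedType.Exports.

Local Open Scope classical_set_scope.
Local Open Scope ring_scope.

Notation borelType X := (g_sigma_algebraType (@open X)).

Section topology.
Variable X : topologicalType.

(* Countable dense subset; second countability is not required. *)
Definition separable := exists2 S : set X, countable S & dense S.

End topology.

Section radon.
Context {R : realType} {X : ptopologicalType}.
Variable m : {measure set (borelType X) -> \bar R}.

(* On a second countable locally compact Hausdorff space, the Borel measures  *)
(* finite on compact sets are the Radon measures; in general regularity is    *)
(* not required.                                                              *)
Definition finite_on_compacts := forall K : set X, compact K -> (m K < +oo)%E.

Definition full_support :=
  forall G : set X, open G -> G !=set0 -> (0 < m G)%E.

(* Support of the class of u: complement of the union of all open sets on     *)
(* which u vanishes a.e.                                                      *)
Definition supp (u : borelType X -> R) : set X :=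
  [set x | forall G : set X, open G -> G x ->
    ~ (\forall y \ae m, G y -> u y = 0)].

End radon.

Section forms.
Context d {T : measurableType d} {R : realType}.
Variable m : {measure set T -> \bar R}.
Variables (D : set (T -> R)) (a : (T -> R) -> (T -> R) -> R).
Implicit Types (u v w V : T -> R).

Definition nonzero u := ~ (u = cst 0 %[ae m]).

Definition form_norm u : R := Num.sqrt (a u u + \int[m]_x (u x ^+ 2)).

Record dirichlet_form : Prop := DirichletForm {
  df_sub : forall u, D u -> u \in Lfun m 2%:E ;
  df_ae : forall u v, D u -> measurable_fun setT v -> u = v %[ae m] -> D v ;
  df_dom0 : D (cst 0) ;
  df_domD : forall c u v, D u -> D v -> D ((c \*o u) \+ v) ;
  df_dense : forall f, f \in Lfun m 2%:E -> forall e : R, 0 < e ->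
    exists2 u, D u & ('N[m]_2%:E[EFin \o (f \- u)%R] < e%:E)%E ;
  (* with df_sym: the form only depends on a.e. classes *)
  df_form_ae : forall u v w, D u -> D v -> D w -> u = v %[ae m] ->
    a u w = a v w ;
  df_linear : forall c u v w, D u -> D v -> D w ->
    a ((c \*o u) \+ v) w = c * a u w + a v w ;
  df_sym : forall u v, D u -> D v -> a u v = a v u ;
  df_ge0 : forall u, D u -> 0 <= a u u ;
  df_complete : forall u_ : nat -> T -> R, (forall n, D (u_ n)) ->
    (forall e : R, 0 < e -> exists N, forall i j, (N <= i)%N -> (N <= j)%N ->
      form_norm (u_ i \- u_ j) < e) ->
    exists2 u, D u & form_norm (u_ n \- u) @[n --> \oo] --> (0 : R) ;
  df_markov : forall u, D u ->
    let v := fun x => Num.min 1 (Num.max (u x) 0) in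
    D v /\ a v v <= a u u }.

Definition compact_embedding :=
  forall (u_ : nat -> T -> R) (C : R),
    (forall n, D (u_ n) /\ form_norm (u_ n) <= C) ->
    exists (phi : nat -> nat) (f : T -> R),
      [/\ {homo phi : i j / (i < j)%N}, f \in Lfun m 2%:E &
          ('N[m]_2%:E[EFin \o (u_ (phi n) \- f)%R])%E @[n --> \oo] --> 0%E].

Definition Lball (p A : R) : set (T -> R) :=
  [set f | f \in Lfun m p%:E /\ ('N[m]_p%:E[EFin \o f] <= A%:E)%E].

(* Weak form of L u + V u = lam u, u in D[a], where L is the generator of a.  *)
Definition weak_solution V (lam : R) u :=
  D u /\ forall w, D w ->
    m.-integrable setT (EFin \o (fun x => V x * u x * w x)) /\
    a u w + \int[m]_x (V x * u x * w x) = lam * \int[m]_x (u x * w x).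

Local Open Scope ereal_scope.

Definition rayleigh V u : \bar R :=
  ((a u u)%:E + \int[m]_x (V x * u x ^+ 2)%:E) / \int[m]_x (u x ^+ 2)%:E.

(* The integral of V u^2 makes sense in [-oo, +oo]; the library assigns the   *)
(* value -oo to an integral of the form +oo - oo.                             *)
Definition rayleigh_defined V u : bool :=
  let f := fun x => (V x * u x ^+ 2)%:E in
  \int[m]_x f^\+ x +? - \int[m]_x f^\- x.

Definition lambda1 V : \bar R :=
  ereal_inf [set rayleigh V u | u in
    [set u | [/\ D u, nonzero u & rayleigh_defined V u]]].

(* Equal to +oo when A > 0 and u is a nonzero element of L^2 outside L^(2q),  *)
(* the norm 'N_(2q) being extended-real valued.                               *)
Definition J (A q : R) u : \bar R :=
  ((a u u)%:E + A%:E * 'N[m]_(2 * q)%:E[EFin \o u] ^+ 2)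
  / 'N[m]_2%:E[EFin \o u] ^+ 2.

Definition first_eigenfunction V u :=
  nonzero u /\ exists2 lam : R, lambda1 V = lam%:E & weak_solution V lam u.

Definition extremal_pair (p A : R) u V :=
  [/\ Lball p A V,
      ereal_sup [set lambda1 W | W in Lball p A] = lambda1 V,
      lambda1 V < +oo &
      first_eigenfunction V u].

End forms.

Section local_forms.
Context {R : realType} {X : ptopologicalType}.
Variable m : {measure set (borelType X) -> \bar R}.
Variables (D : set (borelType X -> R))
          (a : (borelType X -> R) -> (borelType X -> R) -> R).

Definition local_form := forall u v, D u -> D v ->
  supp m u `&` supp m v = set0 -> a u v = 0.

Definition has_cutoffs := forall K G : set X,
  compact K -> open G -> precompact G -> K `<=` G ->
  exists2 u, D u & (\forall x \ae m, K x -> u x = 1) /\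
                   (\forall x \ae m, ~ G x -> u x = 0).

End local_forms.

(* Main.v *)
(* By Hoelder's inequality J(u) is the supremum of the Rayleigh quotients      *)
(* R_W(u) over W in B_A, attained only at W = A ||u^2||_q^(1-q) |u|^(2(q-1)).  *)
(* Hence lambda_1(W) <= J(u) for all W in B_A, and everything follows once a   *)
(* minimizer u >= 0 of J is shown to satisfy lambda_1(V) >= J(u) =: lambda for *)
(* this potential V.                                                           *)
(* Existence: a minimizing sequence converging in L^2 is Cauchy for the form,  *)
(* by the parallelogram law, because u |-> ||u||_2q^2 is convex.               *)
(* Lower bound: a(r, r) <= a(u, u) + t a(w, w) for r = sqrt(u^2 + t w^2), so   *)
(* comparing J(r) with J(u) and letting t -> 0+ yields                         *)
(* a(w, w) + (V w, w) >= lambda (w, w). The quadratic form                     *)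
(* a + V - lambda is then nonnegative and vanishes at u, which is the          *)
(* eigenvalue equation.                                                        *)
Require Import Defs.
From HB Require Import structures.
From mathcomp Require Import all_boot all_order all_algebra.
From mathcomp Require Import all_classical all_reals all_analysis.
From mathcomp Require Import measurable_realfun ring lra.

Set Implicit Arguments.
Unset Strict Implicit.
Unset Printing Implicit Defensive.
Import Order.TTheory GRing.Theory Num.Theory.
Import numFieldNormedType.Exports.

Local Open Scope classical_set_scope.
Local Open Scope ring_scope.

(** Duality turns the max-min problem into the minimization of J. For u in L^(2q), Hoelder's
    inequality gives int W u^2 <= A ||u^2||_q for W in B_A, and for nonzero u equality holds only at
    W = [qpotential u] ([pairing_le], [pairing_eq]). So J(u) is the maximum over W of R_W(u), and
    sup inf <= inf sup bounds every lambda_1(W) by Lam = inf J. What remains is to show that a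
    minimizer of J and its potential form a saddle point.

    Existence ([exists_minimizer]): the compact embedding gives an L^2-convergent normalized
    minimizing sequence. Since ||u||_2q^2 is convex, the parallelogram law makes it Cauchy in D
    ([minimizing_cauchy]). The norm of the limit is controlled by pairing with bounded potentials
    ([limit_cut_bound]) and Fatou's lemma, and taking absolute values makes the minimizer
    nonnegative.

    Saddle point: with V = [qpotential u], one needs lambda_1(V) >= Lam. Perturbing the square of u
    rather than u itself, r = sqrt(u^2 + t w^2), makes ||r||_2^2 and each pairing int W r^2 affine
    in t, while a(r, r) <= a(u, u) + t a(w, w). The comparison J(r) >= J(u) then leaves, as t tends
    to 0+, the inequality a(w, w) + int V w^2 >= Lam (w, w) on D and L^(2q) ([directional]), which
    truncation extends to D ([lower_bound]). Equality holds at w = u, so the first variation there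
    vanishes: this is the eigenvalue equation ([weak_dom2q], [weak_form]). Testing lambda_1(W) with
    u for another maximizer W forces equality in Hoelder's inequality ([maximizer_unique]).

    The energy inequality for square roots ([sqrt_contraction]) comes from the Markov property
    through resolvents: contraction under positive parts makes the resolvent positivity preserving
    ([resolves_ge0]), positivity yields a pointwise Cauchy-Schwarz inequality for resolvents
    ([resolves_plane]), and lower semicontinuity ([form_lsc]) carries the estimate from the Yosida
    approximations to the form. *)

Definition lincomb {T : Type} {R : realType} (c : R) (u : T -> R) (e : R) (v : T -> R)
  : T -> R := fun x => c * u x + e * v x.

(** * Real-valued integrals *)

Section integrals.
Context d {T : measurableType d} {R : realType}.
Variable m : {measure set T -> \bar R}.
Implicit Types (f g u v w : T -> R).

Local Notation int f := (m.-integrable setT (EFin \o f)).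
Local Notation I f := (Rintegral m setT f).

Lemma integrable_measurable f : int f -> measurable_fun setT f.
Proof. by move=> /measurable_int/measurable_EFinP. Qed.

Lemma integrable_lincomb c e f g : int f -> int g -> int (lincomb c f e g).
Proof.
move=> fi gi.
have := integrableD (measurableT) (integrableZl measurableT c fi)
  (integrableZl measurableT e gi).
by apply: eq_integrable => // x _; rewrite /lincomb /= EFinD !EFinM.
Qed.

Lemma Rintegral_lincomb c e f g : int f -> int g -> I (lincomb c f e g) = c * I f + e * I g.
Proof.
move=> fi gi; rewrite /lincomb RintegralD//.
- by rewrite !RintegralZl.
- have := integrableZl measurableT c fi.
  by apply: eq_integrable => // x _; rewrite /= EFinM.
- have := integrableZl measurableT e gi.
  by apply: eq_integrable => // x _; rewrite /= EFinM.
Qed.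

Lemma integrable_dominated f g : measurable_fun setT f -> (forall x, `|f x| <= g x) ->
  int g -> int f.
Proof.
move=> mf fg; apply: le_integrable => //; first exact/measurable_EFinP.
by move=> x _ /=; rewrite lee_fin (le_trans (fg x))// ler_norm.
Qed.

Lemma integrable_scale c f : int f -> int (fun x => c * f x).
Proof.
move=> fi; have := integrableZl measurableT c fi.
by apply: eq_integrable => // x _; rewrite /= EFinM.
Qed.

Lemma Rintegral_scale c f : int f -> I (fun x => c * f x) = c * I f.
Proof. by move=> fi; rewrite RintegralZl. Qed.

Lemma Rintegral_le f g : int f -> int g -> (forall x, f x <= g x) -> I f <= I g.
Proof. by move=> fi gi fg; apply: le_Rintegral. Qed.

Lemma Rintegral_nonneg f : (forall x, 0 <= f x) -> 0 <= I f.
Proof. by move=> f0; apply: Rintegral_ge0. Qed.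

Lemma EFin_Rintegral f : int f -> (I f)%:E = (\int[m]_x (f x)%:E)%E.
Proof. by move=> fi; rewrite /Rintegral fineK//; exact: integrable_fin_num. Qed.

Lemma ae_eq_integrable f g : measurable_fun setT g -> f = g %[ae m] -> int f -> int g.
Proof.
move=> mg fg /integrableP[mf foo]; apply/integrableP; split.
  exact/measurable_EFinP.
rewrite (ae_eq_integral (fun x => `|(f x)%:E|)%E)//.
- by apply/measurableT_comp => //; exact/measurable_EFinP.
- by apply/measurableT_comp.
- by apply: filterS fg => x /= fg _; rewrite fg.
Qed.

Lemma ae_eq_Rintegral f g : measurable_fun setT f -> measurable_fun setT g ->
  f = g %[ae m] -> I f = I g.
Proof.
move=> mf mg fg; rewrite /Rintegral; congr fine; apply: ae_eq_integral => //.
- exact/measurable_EFinP.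
- exact/measurable_EFinP.
- by apply: filterS fg => x /= fg _; rewrite fg.
Qed.

Lemma ae_le_Rintegral f g : int f -> int g -> (\forall x \ae m, f x <= g x) ->
  I f <= I g.
Proof.
move=> fi gi fg.
have mf := integrable_measurable fi; have mg := integrable_measurable gi.
pose h x := Num.min (f x) (g x).
have mh : measurable_fun setT h by exact: measurable_minr.
have fh : f = h %[ae m].
  by apply: filterS fg => x fg _; rewrite /h; apply/esym/min_idPl.
rewrite (ae_eq_Rintegral mf mh fh); apply: Rintegral_le => //; first exact: ae_eq_integrable fh fi.
by move=> x; rewrite /h ge_min lexx orbT.
Qed.

Lemma Rintegral_le0_ae_eq0 f : int f -> (forall x, 0 <= f x) -> I f <= 0 ->
  f = cst 0 %[ae m].
Proof.
move=> fi f0 If.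
have {}If : I f = 0 by apply/eqP; rewrite eq_le If Rintegral_nonneg.
have mf : measurable_fun setT (EFin \o f) by case/integrableP: fi.
have := (ae_eq_integral_abs m measurableT mf).1; case.
  under eq_integral do rewrite gee0_abs ?lee_fin//.
  by rewrite -EFin_Rintegral// If.
move=> N [mN N0 sN]; exists N; split => // x /= h; apply: sN => /= h1.
by apply: h => _; by have [] := h1 Logic.I.
Qed.

Lemma Rintegral_dominated_cvg (f_ : nat -> T -> R) f g :
  (forall n, measurable_fun setT (f_ n)) -> measurable_fun setT f ->
  (forall x, f_ n x @[n --> \oo] --> f x) -> int g ->
  (forall n x, `|f_ n x| <= g x) ->
  I (f_ n) @[n --> \oo] --> I f.
Proof.
move=> mf_ mf ff gi fg.
have [] := @dominated_convergence _ _ _ m setT measurableT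
  (fun n => EFin \o f_ n) (EFin \o f) (EFin \o g).
- by move=> n; exact/measurable_EFinP.
- exact/measurable_EFinP.
- apply: aeW => x _; apply: cvg_EFin; last exact: ff.
  by apply: nearW.
- exact: gi.
- by apply: aeW => x n _ /=; rewrite lee_fin.
move=> fi _ h; have fni n : int (f_ n) by apply: integrable_dominated (fg n) gi.
apply: fine_cvg; rewrite fineK; first exact: h.
exact: integrable_fin_num.
Qed.

(** Besides the estimate, the uniform bound yields integrability of the limit. This is how the
    minimizer is placed in L^(2q) and how V u w is shown integrable. *)
Lemma Rintegral_fatou (f_ : nat -> T -> R) f C :
  measurable_fun setT f -> (forall n x, 0 <= f_ n x) -> (forall x, 0 <= f x) ->
  (forall x, f_ n x @[n --> \oo] --> f x) ->
  (forall n, int (f_ n)) -> (forall n, I (f_ n) <= C) ->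
  int f /\ I f <= C.
Proof.
move=> mf f_0 f0 ff fi IC.
have le : (\int[m]_x (f x)%:E <= C%:E)%E.
  have := @fatou _ _ _ m setT measurableT (fun n => EFin \o f_ n).
  move=> /(_ _ _) /le_trans h.
  rewrite (_ : (\int[m]_x (f x)%:E)%E =
      (\int[m]_x limn_einf (fun n => (EFin \o f_ n) x))%E); last first.
    apply: eq_integral => x _; apply/esym.
    have fx : (EFin \o f_ n) x @[n --> \oo] --> (f x)%:E.
      by apply: cvg_EFin; [exact: nearW|exact: ff].
    by rewrite (cvg_limn_einf_sup fx).
  apply: h.
  - by move=> n; apply/measurable_EFinP; exact: integrable_measurable.
  - by move=> n x _; rewrite lee_fin.
  - rewrite limn_einf_lim; apply: lime_le; first exact: is_cvg_einfs.
    apply: nearW => n; apply: le_trans (_ : (\int[m]_x (f_ n x)%:E <= _)%E).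
      by apply: ereal_inf_lbound; exists n => //=.
    by rewrite -EFin_Rintegral ?lee_fin.
have fi' : int f.
  apply/integrableP; split; first exact/measurable_EFinP.
  under eq_integral do rewrite /= ger0_norm//.
  by rewrite (le_lt_trans le)// ltry.
by split=> //; rewrite -lee_fin EFin_Rintegral.
Qed.

End integrals.

(** * Nonnegative symmetric bilinear forms *)

(** One interface for the Dirichlet form, the L^2 inner product and the pairing with a nonnegative
    potential, each on its own domain. Scalar multiples are written [lincomb c u 0 u], so that
    [psd_quad] covers them too. *)
Record psd (T : Type) (R : realType) (S : set (T -> R))
    (B : (T -> R) -> (T -> R) -> R) : Prop := Psd {
  psd_cl : forall c e u v, S u -> S v -> S (lincomb c u e v) ;
  psd_lin : forall c e u v w, S u -> S v -> S w ->
    B (lincomb c u e v) w = c * B u w + e * B v w ;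
  psd_sym : forall u v, S u -> S v -> B u v = B v u ;
  psd_ge0 : forall u, S u -> 0 <= B u u }.

Lemma quad_lin0 (R : realType) (x y : R) :
  (forall t, 0 <= 2 * t * x + t ^+ 2 * y) -> x = 0.
Proof.
move=> h.
have y0 : 0 <= y by have := h 1; have := h (-1); lra.
(* The minimum is at -x/y; the shift to 1 + y covers y = 0 and still gives a negative value unless x
   = 0. *)
have := h (- x / (1 + y)).
have -> : 2 * (- x / (1 + y)) * x + (- x / (1 + y)) ^+ 2 * y =
    - (x ^+ 2 * ((2 + y) / (1 + y) ^+ 2)) by field; lra.
rewrite oppr_ge0 pmulr_lle0; last by rewrite divr_gt0 ?exprn_gt0//; lra.
by move=> x2; apply/eqP; rewrite -sqrf_eq0 eq_le x2 sqr_ge0.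
Qed.

Lemma cvg0_sqr_le (R : realType) (x y : nat -> R) :
  (forall n, x n ^+ 2 <= y n) -> y n @[n --> \oo] --> 0 ->
  x n @[n --> \oo] --> 0.
Proof.
move=> xy y0; apply/norm_cvg0P.
apply: (@squeeze_cvgr _ _ _ _ (cst 0) (fun n => Num.sqrt (y n))).
- by apply: nearW => n /=; rewrite normr_ge0/= -sqrtr_sqr ler_wsqrtr.
- exact: cvg_cst.
- have := cvg_comp _ _ y0 (@sqrt_continuous R 0).
  by rewrite sqrtr0.
Qed.

Lemma seq_cvg_ext (R : realType) (u v : nat -> R) (l l' : R) :
  u n @[n --> \oo] --> l -> (forall n, v n = u n) -> l' = l ->
  v n @[n --> \oo] --> l'.
Proof. by move=> ul vu ->; rewrite (_ : v = u)//; exact/funext. Qed.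

Section real_sequences.
Context {R : realType}.
Implicit Types (u v : nat -> R) (k l : R).

Lemma seq_cvg_cst k : (fun=> k : R) n @[n --> \oo] --> k.
Proof. exact: cvg_cst. Qed.

Lemma seq_cvgD u v k l : u n @[n --> \oo] --> k -> v n @[n --> \oo] --> l ->
  u n + v n @[n --> \oo] --> k + l.
Proof. exact: cvgD. Qed.

Lemma seq_cvgB u v k l : u n @[n --> \oo] --> k -> v n @[n --> \oo] --> l ->
  u n - v n @[n --> \oo] --> k - l.
Proof. exact: cvgB. Qed.

Lemma seq_cvgM u v k l : u n @[n --> \oo] --> k -> v n @[n --> \oo] --> l ->
  u n * v n @[n --> \oo] --> k * l.
Proof. exact: cvgM. Qed.

Lemma seq_cvgMr u k l : u n @[n --> \oo] --> l -> k * u n @[n --> \oo] --> k * l.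
Proof. exact: cvgMr. Qed.

End real_sequences.

Section psd_theory.
Context {T : Type} {R : realType} {S : set (T -> R)}.
Context {B : (T -> R) -> (T -> R) -> R}.
Hypothesis H : psd S B.

Lemma psd_linr c e u v w : S u -> S v -> S w ->
  B w (lincomb c u e v) = c * B w u + e * B w v.
Proof.
move=> Su Sv Sw; have Sl := psd_cl H c e Su Sv.
by rewrite (psd_sym H)// (psd_lin H)// !(psd_sym H _ Sw).
Qed.

Lemma psd_quad c e u v : S u -> S v ->
  B (lincomb c u e v) (lincomb c u e v) =
  c ^+ 2 * B u u + 2 * c * e * B u v + e ^+ 2 * B v v.
Proof.
move=> Su Sv; have Sl := psd_cl H c e Su Sv.
rewrite (psd_lin H)// !psd_linr// (psd_sym H Sv Su); ring.
Qed.

Lemma psd_cs u v : S u -> S v -> B u v ^+ 2 <= B u u * B v v.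
Proof.
move=> Su Sv.
have u0 := psd_ge0 H Su; have v0 := psd_ge0 H Sv.
have h c e := psd_ge0 H (psd_cl H c e Su Sv).
have {}h c e : 0 <= c ^+ 2 * B u u + 2 * c * e * B u v + e ^+ 2 * B v v.
  by rewrite -psd_quad.
have [v1|v1] := eqVneq (B v v) 0.
  have -> : B u v = 0.
    have [u1|u1] := eqVneq (B u u) 0.
      by have := h 1 1; have := h 1 (-1); rewrite v1 u1; lra.
    have := h (- B u v) (B u u); rewrite v1.
    have -> : (- B u v) ^+ 2 * B u u + 2 * (- B u v) * B u u * B u v +
      B u u ^+ 2 * 0 = - (B u v ^+ 2 * B u u) by ring.
    rewrite oppr_ge0 pmulr_lle0 ?lt0r ?u1//.
    by move=> x2; apply/eqP; rewrite -sqrf_eq0 eq_le x2 sqr_ge0.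
  by rewrite expr0n/= mulr_ge0.
have := h (B v v) (- B u v).
have -> : B v v ^+ 2 * B u u + 2 * B v v * (- B u v) * B u v +
   (- B u v) ^+ 2 * B v v = B v v * (B u u * B v v - B u v ^+ 2) by ring.
by rewrite pmulr_rge0 ?subr_ge0// lt0r v1.
Qed.

(** Parallelogram law through the midpoint: upper bounds at [u] and [v] and a lower bound at their
    midpoint force them to be close. The Cauchy arguments for almost-minimizers rest on it. *)
Lemma psd_mid u v : S u -> S v ->
  B (lincomb 1 u (-1) v) (lincomb 1 u (-1) v) =
  2 * B u u + 2 * B v v - 4 * B (lincomb 2^-1 u 2^-1 v) (lincomb 2^-1 u 2^-1 v).
Proof. by move=> Su Sv; rewrite !psd_quad//; field. Qed.

Lemma psd_mid_le u v : S u -> S v ->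
  B (lincomb 1 u (-1) v) (lincomb 1 u (-1) v) <= 2 * B u u + 2 * B v v.
Proof.
move=> Su Sv; rewrite psd_mid//.
have := psd_ge0 H (psd_cl H 2^-1 2^-1 Su Sv); lra.
Qed.

Section limits.
Variables (v_ : nat -> T -> R) (g : T -> R).
Hypotheses (Sv : forall n, S (v_ n)) (Sg : S g).
Hypothesis vg : B (lincomb 1 (v_ n) (-1) g) (lincomb 1 (v_ n) (-1) g) @[n --> \oo] --> 0.

Lemma psd_cvg w : S w -> B (v_ n) w @[n --> \oo] --> B g w.
Proof.
move=> Sw.
have h : (B (lincomb 1 (v_ n) (-1) g) w)  @[n --> \oo] --> 0.
  apply: (@cvg0_sqr_le _ _
    (fun n => B (lincomb 1 (v_ n) (-1) g) (lincomb 1 (v_ n) (-1) g) * B w w)).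
    by move=> n; apply: psd_cs => //; exact: (psd_cl H).
  by apply: (seq_cvg_ext (seq_cvgMr (k := B w w) vg)) => //; [move=> n; rewrite mulrC|rewrite mulr0].
apply: (seq_cvg_ext (seq_cvgD h (cvg_cst (B g w)))); last by rewrite add0r.
by move=> n /=; rewrite (psd_lin H)//; ring.
Qed.

Lemma psd_cvg_diag : B (v_ n) (v_ n) @[n --> \oo] --> B g g.
Proof.
have h := psd_cvg Sg.
apply: (seq_cvg_ext (seq_cvgD vg (seq_cvgB (seq_cvgMr (k := 2) h) (cvg_cst (B g g))))).
  by move=> n; rewrite psd_quad//; ring.
by ring.
Qed.

End limits.
End psd_theory.

Lemma cvg0P (R : realType) (x : nat -> R) : (forall n, 0 <= x n) ->
  x n @[n --> \oo] --> 0 <->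
  (forall e, 0 < e -> exists N, forall n, (N <= n)%N -> x n < e).
Proof.
move=> x0; split.
  move=> /cvgrPdist_lt h e e0; have [N _ hN] := h e e0.
  by exists N => n Nn; have := hN n Nn; rewrite /= sub0r normrN ger0_norm.
move=> h; apply/cvgrPdist_lt => e e0; have [N hN] := h e e0.
by exists N => // n /hN; rewrite /= sub0r normrN ger0_norm.
Qed.

Lemma cvg0_harmonic (R : realType) (x : nat -> R) (C : R) :
  (forall n, 0 <= x n) -> (forall n, x n <= C * n.+1%:R^-1) ->
  x n @[n --> \oo] --> 0.
Proof.
move=> x0 xC; apply: (squeeze_cvgr (f := cst 0) (h := fun n => C * n.+1%:R^-1)).
- by apply: nearW => n /=; rewrite x0 xC.
- exact: cvg_cst.
- have h : (n.+1%:R^-1 : R) @[n --> \oo] --> (0 : R) by exact: cvg_harmonic.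
  by have := seq_cvgMr (k := C) h; rewrite mulr0.
Qed.

(** * The inner product of L^2 *)

Section L2.
Context d {T : measurableType d} {R : realType}.
Variable m : {measure set T -> \bar R}.
Implicit Types (f g u v w : T -> R).

Local Notation int f := (m.-integrable setT (EFin \o f)).
Local Notation I f := (Rintegral m setT f).

Definition inner_prod u v : R := I (fun x => u x * v x).
Local Notation ip := inner_prod.

Lemma Lfun_measurable r f : f \in Lfun m r -> measurable_fun setT f.
Proof. by rewrite inE => /andP[]; rewrite inE. Qed.

Lemma Lnorm_I r f : 0 < r -> int (fun x => `|f x| `^ r) ->
  'N[m]_r%:E[EFin \o f]%E = ((I (fun x => `|f x| `^ r)) `^ r^-1)%:E.
Proof.
move=> r0 fi; rewrite unlock /= -poweR_EFin EFin_Rintegral//; congr (_ `^ _)%E.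
Qed.

Lemma Lfun_I r f : 0 < r -> measurable_fun setT f ->
  int (fun x => `|f x| `^ r) -> f \in Lfun m r%:E.
Proof.
move=> r0 mf fi; rewrite inE; apply/andP; split; first by rewrite inE.
by rewrite inE /= /finite_norm Lnorm_I// ltry.
Qed.

Lemma L2_sqr f : f \in Lfun m 2%:E -> int (fun x => f x * f x).
Proof. by move=> /Lfun2_integrable_sqr; under eq_fun do rewrite expr2. Qed.

Lemma measurable_L2 f : measurable_fun setT f -> int (fun x => f x * f x) ->
  f \in Lfun m 2%:E.
Proof.
move=> mf fi; apply: Lfun_I => //.
by apply: eq_integrable fi => // x _ /=; rewrite powR_mulrn// -normrX ger0_norm ?sqr_ge0.
Qed.

Lemma L2_mul u v : u \in Lfun m 2%:E -> v \in Lfun m 2%:E ->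
  int (fun x => u x * v x).
Proof. by move=> u2 v2; apply/Lfun1_integrable; exact: Lfun2_mul_Lfun1. Qed.

Lemma L2_lincomb c e u v : u \in Lfun m 2%:E -> v \in Lfun m 2%:E ->
  lincomb c u e v \in Lfun m 2%:E.
Proof.
move=> u2 v2; apply: measurable_L2.
  by apply: measurable_funD; apply: measurable_funM => //; [exact: Lfun_measurable u2|exact: Lfun_measurable v2].
have := integrable_lincomb 1 1 (integrable_lincomb (c ^+ 2) (c * e *+ 2) (L2_sqr u2) (L2_mul u2 v2))
   (integrable_scale (e ^+ 2) (L2_sqr v2)).
apply: eq_integrable => // x _ /=; congr EFin; rewrite /lincomb; ring.
Qed.

Lemma inner_psd : psd [set u | u \in Lfun m 2%:E] ip.
Proof.
split=> /=.
- exact: L2_lincomb.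
- move=> c e u v w u2 v2 w2; rewrite /ip -Rintegral_lincomb; [|exact: L2_mul|exact: L2_mul].
  by congr (Rintegral _ _ _); apply/funext => x; rewrite /lincomb; ring.
- by move=> u v _ _; rewrite /ip; under eq_Rintegral do rewrite mulrC.
- by move=> u _; apply: Rintegral_nonneg => x; rewrite -expr2 sqr_ge0.
Qed.

Lemma inner_ge0 u : 0 <= ip u u.
Proof. by apply: Rintegral_nonneg => x; rewrite -expr2 sqr_ge0. Qed.

Lemma inner_eq0 u : u \in Lfun m 2%:E -> ip u u <= 0 -> u = cst 0 %[ae m].
Proof.
move=> u2 /(Rintegral_le0_ae_eq0 (L2_sqr u2)) h.
have {}h := h (fun x => ltac:(rewrite -expr2; exact: sqr_ge0)).
apply: filterS h => x /(_ Logic.I) /= /eqP + _; rewrite mulf_eq0 orbb.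
by move=> /eqP.
Qed.

Lemma Lnorm_inner u : u \in Lfun m 2%:E ->
  'N[m]_2%:E[EFin \o u]%E = (Num.sqrt (ip u u))%:E.
Proof.
move=> u2; have := L2_sqr u2; have E x : `|u x| `^ 2 = u x * u x.
  by rewrite powR_mulrn// -normrX ger0_norm ?sqr_ge0.
move=> ui; rewrite Lnorm_I//; last by apply: eq_integrable ui => // x _ /=; rewrite E.
have -> : I (fun x => `|u x| `^ 2) = ip u u by apply: eq_Rintegral => x _; rewrite E.
by rewrite powR12_sqrt// inner_ge0.
Qed.

Lemma inner_cvg0 (u_ : nat -> T -> R) f : (forall n, u_ n \in Lfun m 2%:E) ->
  f \in Lfun m 2%:E ->
  ('N[m]_2%:E[EFin \o (u_ n \- f)%R])%E @[n --> \oo] --> 0%E ->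
  ip (lincomb 1 (u_ n) (-1) f) (lincomb 1 (u_ n) (-1) f) @[n --> \oo] --> 0.
Proof.
move=> u2 f2 h.
have E n : (u_ n \- f)%R = lincomb 1 (u_ n) (-1) f.
  by apply/funext => x; rewrite /lincomb /= mul1r mulN1r.
have l2 n := L2_lincomb 1 (-1) (u2 n) f2.
have {}h : Num.sqrt (ip (lincomb 1 (u_ n) (-1) f) (lincomb 1 (u_ n) (-1) f))
    @[n --> \oo] --> 0.
  suff h' : (Num.sqrt (ip (lincomb 1 (u_ n) (-1) f) (lincomb 1 (u_ n) (-1) f)))%:E
      @[n --> \oo] --> (0 : R)%:E by exact: (fine_cvg h').
  by move: h; under eq_fun do rewrite E Lnorm_inner//.
apply: (seq_cvg_ext (seq_cvgM h h)); last by rewrite mulr0.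
by move=> n; rewrite -[RHS]expr2 sqr_sqrtr ?inner_ge0.
Qed.

End L2.

(** * Elementary limits and the Cauchy-Schwarz inequality in the plane *)

Lemma seq_cvg_le (R : realType) (u v : nat -> R) k l :
  u n @[n --> \oo] --> k -> v n @[n --> \oo] --> l -> (forall n, u n <= v n) ->
  k <= l.
Proof. by move=> uk vl uv; apply: (ler_cvg_to uk vl); exact: nearW. Qed.

Lemma cvg_harmonic_shift (R : realType) (C : R) :
  C + n.+1%:R^-1 @[n --> \oo] --> C.
Proof.
have h : (n.+1%:R^-1 : R) @[n --> \oo] --> (0 : R) by exact: cvg_harmonic.
by apply: (seq_cvg_ext (seq_cvgD (cvg_cst C) h)); rewrite ?addr0.
Qed.

Lemma invS_le (R : realType) (N i : nat) : (N <= i)%N ->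
  (i.+1%:R : R)^-1 <= N.+1%:R^-1.
Proof. by move=> Ni; rewrite lef_pV2 ?posrE ?ltr0n// ler_nat. Qed.

Lemma invS_lt (R : realType) (e : R) : 0 < e ->
  exists N, forall n, (N <= n)%N -> (n.+1%:R)^-1 < e.
Proof.
move=> e0; have h : (n.+1%:R^-1 : R) @[n --> \oo] --> (0 : R) by exact: cvg_harmonic.
by move/cvg0P: h; apply => // n; rewrite invr_ge0.
Qed.

Lemma psd_mid_conv (T : Type) (R : realType) (S : set (T -> R)) B
    (H : psd S B) u v : S u -> S v ->
  B (lincomb 2^-1 u 2^-1 v) (lincomb 2^-1 u 2^-1 v) <= 2^-1 * B u u + 2^-1 * B v v.
Proof.
move=> Su Sv; have := psd_ge0 H (psd_cl H 1 (-1) Su Sv).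
rewrite (psd_mid H)//; lra.
Qed.

Lemma plane_cs (R : realType) (c e x y : R) :
  c * x + e * y <= Num.sqrt (c ^+ 2 + e ^+ 2) * Num.sqrt (x ^+ 2 + y ^+ 2).
Proof.
rewrite -sqrtrM ?addr_ge0 ?sqr_ge0//; apply: le_trans (ler_norm _) _.
rewrite -sqrtr_sqr ler_sqrt ?mulr_ge0 ?addr_ge0 ?sqr_ge0//.
rewrite -subr_ge0; have := sqr_ge0 (c * y - e * x).
by congr (_ <= _); ring.
Qed.

(** Density of the rationals. An a.e. inequality known for each (c, e) holds off a null set
    depending on (c, e), and only countably many such sets can be united. *)
Lemma rat_plane_cs (R : realType) (x y z : R) : 0 <= z ->
  (forall c e : rat, ratr c * x + ratr e * y <=
     Num.sqrt (ratr c ^+ 2 + ratr e ^+ 2) * z) ->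
  forall c e : R, c * x + e * y <= Num.sqrt (c ^+ 2 + e ^+ 2) * z.
Proof.
move=> z0 h c e; apply/ler_addgt0Pr => eps eps0.
(* Moving c and e by less than t changes the left side by at most t (|x| + |y|) and the right side
   by at most 2 t z; the summand 1 only keeps K positive. *)
pose K := `|x| + `|y| + 2 * z + 1.
have K0 : 0 < K by rewrite /K; have := normr_ge0 x; have := normr_ge0 y; lra.
pose t := eps / K.
have t0 : 0 < t by rewrite divr_gt0.
have tK : t * `|x| + t * `|y| + 2 * t * z <= eps.
  have -> : eps = t * K by rewrite /t divfK// gt_eqF.
  by rewrite /K; lra.
have [c' hc] : exists c' : rat, `|c - ratr c'| < t.
  have [c'] := @rat_in_itvoo _ (c - t) (c + t) ltac:(lra).
  by rewrite in_itv/= => /andP[h1 h2]; exists c'; rewrite ltr_norml; lra.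
have [e' he] : exists e' : rat, `|e - ratr e'| < t.
  have [e'] := @rat_in_itvoo _ (e - t) (e + t) ltac:(lra).
  by rewrite in_itv/= => /andP[h1 h2]; exists e'; rewrite ltr_norml; lra.
have := h c' e'.
set C : R := ratr c' in hc *; set E : R := ratr e' in he *.
set r := Num.sqrt (c ^+ 2 + e ^+ 2) => hh.
have r0 : 0 <= r by exact: sqrtr_ge0.
have r2 : r ^+ 2 = c ^+ 2 + e ^+ 2 by rewrite sqr_sqrtr// addr_ge0// sqr_ge0.
have cr : `|c| <= r.
  by rewrite -sqrtr_sqr ler_wsqrtr// lerDl sqr_ge0.
have er : `|e| <= r.
  by rewrite -sqrtr_sqr ler_wsqrtr// lerDr sqr_ge0.
have Cr : `|C| <= r + t.
  by rewrite -(subrK c C); apply: le_trans (ler_normD _ _) _; rewrite distrC addrC lerD// ltW.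
have Er : `|E| <= `|e| + t.
  by rewrite -(subrK e E); apply: le_trans (ler_normD _ _) _; rewrite distrC addrC lerD// ltW.
have Cc : `|C| <= `|c| + t.
  by rewrite -(subrK c C); apply: le_trans (ler_normD _ _) _; rewrite distrC addrC lerD// ltW.
have sq : Num.sqrt (C ^+ 2 + E ^+ 2) <= r + 2 * t.
  have rt : 0 <= r + 2 * t by lra.
  rewrite -[leRHS]ger0_norm// -sqrtr_sqr ler_wsqrtr//.
  have C2 : C ^+ 2 <= (`|c| + t) ^+ 2.
    by rewrite -(real_normK (num_real C)) lerXn2r ?nnegrE ?addr_ge0// ltW.
  have E2 : E ^+ 2 <= (`|e| + t) ^+ 2.
    by rewrite -(real_normK (num_real E)) lerXn2r ?nnegrE ?addr_ge0// ltW.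
  have : (`|c| + t) ^+ 2 + (`|e| + t) ^+ 2 <= (r + 2 * t) ^+ 2.
    rewrite !sqrrD !real_normK ?num_real// r2.
    have : t * `|c| <= t * r by rewrite ler_wpM2l// ltW.
    have : t * `|e| <= t * r by rewrite ler_wpM2l// ltW.
    have : 0 <= t ^+ 2 by exact: sqr_ge0.
    rewrite !mulr2n; lra.
  lra.
have d1 : (c - C) * x <= t * `|x|.
  by rewrite (le_trans (ler_norm _))// normrM ler_wpM2r// ltW.
have d2 : (e - E) * y <= t * `|y|.
  by rewrite (le_trans (ler_norm _))// normrM ler_wpM2r// ltW.
have d3 : Num.sqrt (C ^+ 2 + E ^+ 2) * z <= (r + 2 * t) * z by rewrite ler_wpM2r.
lra.
Qed.

(** * Contraction properties of Dirichlet forms *)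

Section form.
Context d {T : measurableType d} {R : realType}.
Variable m : {measure set T -> \bar R}.
Variables (D : set (T -> R)) (a : (T -> R) -> (T -> R) -> R).
Hypothesis df : dirichlet_form m D a.
Implicit Types (f g u v w : T -> R).
Local Notation I f := (Rintegral m setT f).
Local Notation ip := (inner_prod m).
Local Notation L2 := (Lfun m 2%:E).

Lemma dom_L2 u : D u -> u \in Lfun m 2%:E.
Proof. exact: (df_sub df). Qed.

Lemma dom_measurable u : D u -> measurable_fun setT u.
Proof. by move=> /dom_L2/Lfun_measurable. Qed.

Lemma dom_lincomb c e u v : D u -> D v -> D (lincomb c u e v).
Proof.
move=> Du Dv; apply: (df_domD df) => //.
rewrite (_ : (fun x => e * v x) = (e \*o v) \+ cst 0).
  by apply: (df_domD df) => //; exact: (df_dom0 df).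
by apply/funext => x /=; rewrite addr0.
Qed.

Lemma form_psd : psd D a.
Proof.
have D0 := df_dom0 df.
split; first exact: dom_lincomb.
- move=> c e u v w Du Dv Dw.
  have a0 : a (cst 0) w = 0.
    have := df_linear df 1 D0 D0 Dw.
    rewrite (_ : (1 \*o cst 0) \+ cst 0 = cst 0); first by lra.
    by apply/funext => x /=; rewrite mulr0 addr0.
  have E : (e \*o v) \+ cst 0 = (fun x => e * v x).
    by apply/funext => x /=; rewrite addr0.
  have Dev : D (fun x => e * v x) by rewrite -E; exact: (df_domD df).
  have := df_linear df e Dv D0 Dw; rewrite E a0 addr0 => <-.
  by rewrite -(df_linear df).
- exact: (df_sym df).
- exact: (df_ge0 df).
Qed.

Lemma dom_inner_psd : psd D ip.
Proof.
have [_ h1 h2 h3] := inner_psd m; split; first exact: dom_lincomb.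
- by move=> *; apply: h1; exact: dom_L2.
- by move=> *; apply: h2; exact: dom_L2.
- by move=> *; apply: h3; exact: dom_L2.
Qed.

Lemma form_ae u v : D u -> D v -> u = v %[ae m] -> a u u = a v v.
Proof.
move=> Du Dv uv; rewrite (df_form_ae df Du Dv Du uv) (df_sym df)//.
exact: (df_form_ae df Du Dv Dv uv).
Qed.

Definition form_cauchy (u_ : nat -> T -> R) :=
  forall e : R, 0 < e -> exists N, forall i j, (N <= i)%N -> (N <= j)%N ->
    a (lincomb 1 (u_ i) (-1) (u_ j)) (lincomb 1 (u_ i) (-1) (u_ j)) +
    ip (lincomb 1 (u_ i) (-1) (u_ j)) (lincomb 1 (u_ i) (-1) (u_ j)) < e.

Lemma form_complete (u_ : nat -> T -> R) : (forall n, D (u_ n)) -> form_cauchy u_ ->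
  exists2 g, D g &
    a (lincomb 1 (u_ n) (-1) g) (lincomb 1 (u_ n) (-1) g) @[n --> \oo] --> 0 /\
    ip (lincomb 1 (u_ n) (-1) g) (lincomb 1 (u_ n) (-1) g) @[n --> \oo] --> 0.
Proof.
move=> Du cu.
have E u v : (u \- v)%R = lincomb 1 u (-1) v.
  by apply/funext => x; rewrite /lincomb /= mul1r mulN1r.
have nE u : form_norm m a u = Num.sqrt (a u u + ip u u).
  by [].
have [e e0|g Dg ug] := df_complete df Du.
  have [|N hN] := cu (e ^+ 2); first by rewrite exprn_gt0.
  exists N => i j Ni Nj; rewrite E nE -[ltRHS]ger0_norm ?ltW// -sqrtr_sqr.
  by rewrite ltr_sqrt ?exprn_gt0//; exact: hN.
exists g => //.
have h : a (lincomb 1 (u_ n) (-1) g) (lincomb 1 (u_ n) (-1) g) +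
  ip (lincomb 1 (u_ n) (-1) g) (lincomb 1 (u_ n) (-1) g) @[n --> \oo] --> 0.
  apply: (seq_cvg_ext (seq_cvgM ug ug)); last by rewrite mulr0.
  move=> n; rewrite E nE -[RHS]expr2 sqr_sqrtr// addr_ge0// ?inner_ge0//.
  by apply: (df_ge0 df); exact: dom_lincomb.
split; [move: h|move: h]; apply: squeeze_cvgr; try exact: cvg_cst.
- apply: nearW => n; rewrite lerDl inner_ge0 andbT.
  by apply: (df_ge0 df); exact: dom_lincomb.
- apply: nearW => n; rewrite lerDr inner_ge0 andTb.
  by apply: (df_ge0 df); exact: dom_lincomb.
Qed.

(* Almost-minimizers of a on the L^2 balls of radii 1/sqrt(n+1) around f are   *)
(* Cauchy by the parallelogram law, so that weak compactness is not needed.    *)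
Lemma form_lsc (v_ : nat -> T -> R) f C : (forall n, D (v_ n)) -> f \in L2 ->
  ip (lincomb 1 (v_ n) (-1) f) (lincomb 1 (v_ n) (-1) f) @[n --> \oo] --> 0 ->
  (forall n, a (v_ n) (v_ n) <= C) -> D f /\ a f f <= C.
Proof.
move=> Dv f2 vf aC.
pose K n := [set v | D v /\ ip (lincomb 1 v (-1) f) (lincomb 1 v (-1) f) <= n.+1%:R^-1].
pose E n := [set a v v | v in K n]; pose b n := inf (E n).
have Kb n : exists2 v, K n v & a v v <= C.
  have [] := (cvg0P (fun n => inner_ge0 m (lincomb 1 (v_ n) (-1) f))).1 vf n.+1%:R^-1.
    by rewrite invr_gt0.
  by move=> N hN; exists (v_ N) => //; split=> //; apply: ltW; exact: hN.
have hE n : has_inf (E n).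
  split; first by have [v Kv _] := Kb n; exists (a v v), v.
  by exists 0 => _ [v [Dv' _] <-]; exact: (df_ge0 df).
have bK n v : K n v -> b n <= a v v.
  by move=> Kv; apply: ge_inf; [exact: (hE n).2|exists v].
have bC n : b n <= C by have [v /bK bv] := Kb n; exact: le_trans.
have Kle n k v : (n <= k)%N -> K k v -> K n v.
  by move=> nk [Dv' vk]; split=> //; apply: le_trans vk (invS_le _ nk).
have ble n k : (n <= k)%N -> b n <= b k.
  move=> nk; apply: lb_le_inf; first exact: (hE k).1.
  by move=> _ [v Kv <-]; apply: bK; exact: Kle Kv.
have /choice[w wP] n : exists w, K n w /\ a w w < b n + n.+1%:R^-1.
  have [|_ [v Kv <-] h] := @inf_adherent _ (E n) n.+1%:R^-1 _ (hE n).
    by rewrite invr_gt0.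
  by exists v.
have Dw n : D (w n) by have [[]] := wP n.
have w2 n := dom_L2 (Dw n).
have wf n : ip (lincomb 1 (w n) (-1) f) (lincomb 1 (w n) (-1) f) <= n.+1%:R^-1.
  by have [[]] := wP n.
have wf0 : ip (lincomb 1 (w n) (-1) f) (lincomb 1 (w n) (-1) f) @[n --> \oo] --> 0.
  apply: (@cvg0_harmonic _ _ 1); first by move=> n; exact: inner_ge0.
  by move=> n; rewrite mul1r.
have wf2 n : lincomb 1 (w n) (-1) f \in L2 by exact: L2_lincomb.
have hsup : has_sup (range b).
  by split; [exists (b 0%N), 0%N|exists C => _ [n _ <-]].
pose L := sup (range b).
have bL n : b n <= L by apply: sup_upper_bound => //; exists n.
have cauchy : form_cauchy w.
  (* The infima [b n] increase to [L]. Beyond N the energy of the difference is at most 4 (e/8) + 4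
     (e/16), and its L^2 part is below 4 (e/16). *)
  move=> e e0; have [|_ [N1 _ <-] hN1] := @sup_adherent _ (range b) (e / 8) _ hsup.
    by rewrite divr_gt0.
  have [|N2 hN2] := @invS_lt R (e / 16); first by rewrite divr_gt0.
  exists (maxn N1 N2) => i j; rewrite !geq_max => /andP[i1 i2] /andP[j1 j2].
  pose N := maxn N1 N2.
  have Ni : (N <= i)%N by rewrite geq_max i1.
  have Nj : (N <= j)%N by rewrite geq_max j1.
  have iN := invS_le R Ni; have jN := invS_le R Nj.
  have Ne : (N.+1%:R : R)^-1 < e / 16 by apply: hN2; rewrite leq_maxr.
  have KN : K N (lincomb 2^-1 (w i) 2^-1 (w j)).
    split; first exact: dom_lincomb.
    rewrite (_ : lincomb 1 _ _ _ = lincomb 2^-1 (lincomb 1 (w i) (-1) f) 2^-1 (lincomb 1 (w j) (-1) f)).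
      apply: le_trans (psd_mid_conv (inner_psd m) (wf2 i) (wf2 j)) _.
      have := le_trans (wf i) iN; have := le_trans (wf j) jN.
      by move: (N.+1%:R^-1) => r; lra.
    by apply/funext => x; rewrite /lincomb; field.
  have am := bK _ _ KN.
  have bN : L - e / 8 < b N by apply: lt_le_trans hN1 (ble _ _ (leq_maxl _ _)).
  have [_ wi] := wP i; have [_ wj] := wP j.
  have ij : lincomb 1 (w i) (-1) (w j) =
      lincomb 1 (lincomb 1 (w i) (-1) f) (-1) (lincomb 1 (w j) (-1) f).
    by apply/funext => x; rewrite /lincomb; ring.
  have := psd_mid_le (inner_psd m) (wf2 i) (wf2 j); rewrite -ij.
  rewrite (psd_mid form_psd)//.
  have := le_trans (wf i) iN; have := le_trans (wf j) jN.
  have := bL i; have := bL j.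
  move: (N.+1%:R^-1) (i.+1%:R^-1) (j.+1%:R^-1) iN jN Ne wi wj => rN ri rj.
  lra.
have [g Dg [awg iwg]] := form_complete Dw cauchy.
have g2 := dom_L2 Dg.
have fg : f = g %[ae m].
  suff h : lincomb 1 f (-1) g = cst 0 %[ae m].
    by apply: filterS h => x h /h; rewrite /lincomb /= mul1r mulN1r => /eqP; rewrite subr_eq0 => /eqP.
  apply: inner_eq0; first exact: L2_lincomb.
  have c1 := seq_cvgD (seq_cvgMr (k := 2) iwg) (seq_cvgMr (k := 2) wf0).
  rewrite !mulr0 addr0 in c1.
  apply: (seq_cvg_le (cvg_cst _) c1) => n /=.
  have -> : lincomb 1 f (-1) g = lincomb 1 (lincomb 1 (w n) (-1) g) (-1) (lincomb 1 (w n) (-1) f).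
    by apply/funext => x; rewrite /lincomb; ring.
  by apply: (psd_mid_le (inner_psd m)) => //; exact: L2_lincomb.
have Df : D f.
  apply: (df_ae df Dg); first exact: Lfun_measurable f2.
  by apply: filterS fg => x h /h.
split=> //; rewrite (form_ae Df Dg fg).
have c1 := psd_cvg_diag form_psd Dw Dg awg.
apply: (seq_cvg_le c1 (cvg_harmonic_shift (C := C))) => n.
have [_ /ltW/le_trans] := wP n; apply; by rewrite lerD2r.
Qed.

(** The Markov property applied to u / k and scaled back. *)
Lemma truncation u k : 0 < k -> D u ->
  let v := fun x => Num.min k (Num.max (u x) 0) in D v /\ a v v <= a u u.
Proof.
move=> k0 Du v.
have Duk : D (lincomb k^-1 u 0 u) by exact: dom_lincomb.
have [] := df_markov df Duk.
set z := fun x => _ => Dz az.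
have vE : v = lincomb k z 0 z.
  apply/funext => x; rewrite /lincomb /z /v !mul0r !addr0.
  rewrite minr_pMr ?ltW// mulr1 maxr_pMr ?ltW// mulr0.
  by rewrite /lincomb mul0r addr0 mulrA divff ?gt_eqF// mul1r.
split; first by rewrite vE; exact: dom_lincomb.
rewrite vE (psd_quad form_psd)//.
move: az; rewrite (psd_quad form_psd)// => az.
apply: (@le_trans _ _ (k ^+ 2 * a z z)); first by rewrite mulr0 expr0n/= !mul0r !addr0.
apply: (@le_trans _ _ (k ^+ 2 * (k^-1 ^+ 2 * a u u))).
  by rewrite ler_wpM2l ?sqr_ge0//; move: az; rewrite mulr0 expr0n/= !mul0r !addr0.
by rewrite mulrA -exprMn divff ?gt_eqF// expr1n mul1r.
Qed.

Lemma truncation_cvg u : u \in L2 -> (forall x, 0 <= u x) ->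
  ip (lincomb 1 (fun x => Num.min n.+1%:R (u x)) (-1) u)
     (lincomb 1 (fun x => Num.min n.+1%:R (u x)) (-1) u) @[n --> \oo] --> 0.
Proof.
move=> u2 u0.
have mu := Lfun_measurable u2.
pose z n x := lincomb 1 (fun x => Num.min n.+1%:R (u x)) (-1) u x.
have mz n : measurable_fun setT (z n).
  by apply: measurable_funD; apply: measurable_funM => //; exact: measurable_minr.
have zu n x : `|z n x| <= u x.
  rewrite /z /lincomb mul1r mulN1r; have := u0 x; have := ler0n R n.+1.
  by case: (leP n.+1%:R (u x)) => h n0 h0; rewrite ler_norml; lra.
have := @Rintegral_dominated_cvg _ _ _ m (fun n x => z n x * z n x) (cst 0) (fun x => u x * u x).
rewrite (_ : Rintegral m setT (cst 0) = 0); last by rewrite /Rintegral integral0.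
apply.
- by move=> n; exact: measurable_funM.
- exact: measurable_cst.
- move=> x; apply: cvg_near_cst.
  have [N hN] : exists N : nat, u x <= N%:R.
    by exists (Num.bound (u x)); apply: ltW; have := archi_boundP (u0 x).
  exists N => // n /= Nn; rewrite /z /lincomb min_r; first by ring.
  by apply: le_trans hN _; rewrite ler_nat (leq_trans Nn).
- exact: L2_sqr.
- by move=> n x; rewrite normrM ler_pM.
Qed.

(** The truncations to [0, n+1] have energy at most a(u, u) and converge in L^2 to the positive
    part, so [form_lsc] applies. *)
Lemma pos_part u : D u -> let v := fun x => Num.max (u x) 0 in
  D v /\ a v v <= a u u.
Proof.
move=> Du v; have mu := dom_measurable Du.
have mv : measurable_fun setT v by exact: measurable_maxr.
have v2 : v \in L2.
  apply: measurable_L2 => //; apply: integrable_dominated (L2_sqr (dom_L2 Du)).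
    exact: measurable_funM.
  move=> x; rewrite normrM /v -expr2 -[leRHS]expr2.
  by case: (leP (u x) 0) => h; rewrite ?normr0 ?expr0n/= ?sqr_ge0// real_normK// num_real.
apply: (@form_lsc (fun n x => Num.min n.+1%:R (Num.max (u x) 0))) => //.
- by move=> n; have [] := @truncation u n.+1%:R _ Du.
- by apply: truncation_cvg => // x; rewrite le_max lexx orbT.
- by move=> n; have [] := @truncation u n.+1%:R _ Du.
Qed.

(* (L + b) v = b f in the weak sense, i.e. v = b G_b f for the resolvent G_b. *)
Definition resolves (b : R) f v :=
  D v /\ forall w, D w -> a v w + b * ip (lincomb 1 v (-1) f) w = 0.

(** The functional whose Euler-Lagrange equation in [v] is [resolves]; its minimum over [v] is the
    Moreau-Yosida approximation of the form at [f]. *)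
Definition yosida (b : R) f v :=
  a v v + b * ip (lincomb 1 v (-1) f) (lincomb 1 v (-1) f).

Lemma yosida_ge0 b f v : 0 <= b -> D v -> 0 <= yosida b f v.
Proof.
by move=> b0 Dv; rewrite addr_ge0 ?mulr_ge0 ?inner_ge0//; exact: (df_ge0 df).
Qed.

Lemma yosida_expand b f v w t : D v -> D w -> f \in L2 ->
  yosida b f (lincomb 1 v t w) = yosida b f v +
    2 * t * (a v w + b * ip (lincomb 1 v (-1) f) w) + t ^+ 2 * (a w w + b * ip w w).
Proof.
move=> Dv Dw f2; have v2 := dom_L2 Dv; have w2 := dom_L2 Dw.
have vf2 := L2_lincomb 1 (-1) v2 f2.
rewrite /yosida (psd_quad form_psd)//.
have -> : lincomb 1 (lincomb 1 v t w) (-1) f = lincomb 1 (lincomb 1 v (-1) f) t w.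
  by apply/funext => x; rewrite /lincomb; ring.
by rewrite (psd_quad (inner_psd m))//; ring.
Qed.

(** The equation for [v] kills the linear term of the expansion around [v]. The excess is a squared
    distance to [v], so minimality comes with uniqueness. *)
Lemma resolves_min b f v w : 0 <= b -> f \in L2 -> resolves b f v -> D w ->
  yosida b f v + (a (lincomb 1 w (-1) v) (lincomb 1 w (-1) v) +
     b * ip (lincomb 1 w (-1) v) (lincomb 1 w (-1) v)) = yosida b f w.
Proof.
move=> b0 f2 [Dv vP] Dw; have Dwv := dom_lincomb 1 (-1) Dw Dv.
have -> : yosida b f w = yosida b f (lincomb 1 v 1 (lincomb 1 w (-1) v)).
  by congr yosida; apply/funext => x; rewrite /lincomb; ring.
by rewrite yosida_expand// vP//; ring.
Qed.

Lemma resolves_lincomb b f f' v v' c e : f \in L2 -> f' \in L2 ->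
  resolves b f v -> resolves b f' v' ->
  resolves b (lincomb c f e f') (lincomb c v e v').
Proof.
move=> f2 f2' [Dv vP] [Dv' vP']; split; first exact: dom_lincomb.
move=> w Dw; have w2 := dom_L2 Dw.
have vf2 := L2_lincomb 1 (-1) (dom_L2 Dv) f2; have vf2' := L2_lincomb 1 (-1) (dom_L2 Dv') f2'.
rewrite (psd_lin form_psd)//.
have -> : lincomb 1 (lincomb c v e v') (-1) (lincomb c f e f') =
   lincomb c (lincomb 1 v (-1) f) e (lincomb 1 v' (-1) f').
  by apply/funext => x; rewrite /lincomb; ring.
rewrite (psd_lin (inner_psd m))//.
by have := vP w Dw; have := vP' w Dw; nra.
Qed.

(** The minimal value as b (f - b G_b f, f). In this shape the approximations at different [f] can
    be compared through the resolvent alone. *)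
Lemma resolves_energy b f v : f \in L2 -> resolves b f v ->
  yosida b f v = b * (ip f f - ip v f).
Proof.
move=> f2 [Dv vP]; have v2 := dom_L2 Dv; have vf2 := L2_lincomb 1 (-1) v2 f2.
have := vP v Dv; rewrite /yosida (psd_quad (inner_psd m))//.
rewrite (psd_lin (inner_psd m))// (psd_sym (inner_psd m) f2)//; lra.
Qed.

(** Direct method: a minimizing sequence of [yosida b f] is Cauchy by the parallelogram law,
    completeness of D gives a minimizer, and its first variation is the equation. *)
Lemma resolvent b f : 1 <= b -> f \in L2 -> exists v, resolves b f v.
Proof.
move=> b1 f2.
have b0 : 0 <= b by lra.
pose E := [set yosida b f v | v in D].
have hE : has_inf E.
  split; first by exists (yosida b f (cst 0)), (cst 0) => //; exact: (df_dom0 df).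
  by exists 0 => _ [v Dv <-]; exact: yosida_ge0.
have EK v : D v -> inf E <= yosida b f v.
  by move=> Dv; apply: ge_inf; [exact: hE.2|exists v].
have /choice[w wP] n : exists w, D w /\ yosida b f w < inf E + n.+1%:R^-1.
  have [|_ [v Kv <-] h] := @inf_adherent _ E n.+1%:R^-1 _ hE.
    by rewrite invr_gt0.
  by exists v.
have Dw n : D (w n) by have [] := wP n.
have w2 n := dom_L2 (Dw n).
have wf2 n : lincomb 1 (w n) (-1) f \in L2 by exact: L2_lincomb.
have [g Dg [awg iwg]] : exists2 g, D g &
    a (lincomb 1 (w n) (-1) g) (lincomb 1 (w n) (-1) g) @[n --> \oo] --> 0 /\
    ip (lincomb 1 (w n) (-1) g) (lincomb 1 (w n) (-1) g) @[n --> \oo] --> 0.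
  apply: (form_complete Dw) => e e0.
  have [|N hN] := @invS_lt R (e / 4); first by rewrite divr_gt0.
  exists N => i j Ni Nj.
  have [_ wi] := wP i; have [_ wj] := wP j.
  have di := hN i Ni; have dj := hN j Nj.
  have Dmid := dom_lincomb 2^-1 2^-1 (Dw i) (Dw j).
  have := EK _ Dmid.
  have := psd_mid (inner_psd m) (wf2 i) (wf2 j).
  have := psd_mid form_psd (Dw i) (Dw j).
  have := inner_ge0 m (lincomb 1 (w i) (-1) (w j)).
  rewrite /yosida in wi wj *.
  have -> : lincomb 1 (lincomb 1 (w i) (-1) f) (-1) (lincomb 1 (w j) (-1) f) =
    lincomb 1 (w i) (-1) (w j) by apply/funext => x; rewrite /lincomb; ring.
  have -> : lincomb 2^-1 (lincomb 1 (w i) (-1) f) 2^-1 (lincomb 1 (w j) (-1) f) =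
    lincomb 1 (lincomb 2^-1 (w i) 2^-1 (w j)) (-1) f.
    by apply/funext => x; rewrite /lincomb; field.
  move: (ip _ _) (a _ _) => x; move: (i.+1%:R^-1) (j.+1%:R^-1) di dj wi wj.
  move: (inf E) => K ri rj di dj wi wj y x0 -> Ex hK.
  (* Here [1 <= b] enters: the L^2 term weighted by b controls the unweighted one of the form
     norm. *)
  have : x <= b * x by rewrite ler_peMl.
  rewrite {2}Ex; nra.
have g2 := dom_L2 Dg; have gf2 : lincomb 1 g (-1) f \in L2 by exact: L2_lincomb.
have gmin w' : D w' -> yosida b f g <= yosida b f w'.
  move=> Dw'; apply: le_trans (EK _ Dw').
  have c1 := psd_cvg_diag form_psd Dw Dg awg.
  have c2 : ip (lincomb 1 (w n) (-1) f) (lincomb 1 (w n) (-1) f) @[n --> \oo] -->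
      ip (lincomb 1 g (-1) f) (lincomb 1 g (-1) f).
    apply: (psd_cvg_diag (inner_psd m) wf2 gf2).
    apply: (seq_cvg_ext iwg) => // n.
    by congr ip; apply/funext => x; rewrite /lincomb; ring.
  apply: (seq_cvg_le (seq_cvgD c1 (seq_cvgMr (k := b) c2))
     (cvg_harmonic_shift (C := inf E))) => n.
  by apply: ltW; exact: (wP n).2.
exists g; split=> // w' Dw'; apply: (@quad_lin0 _ _ (a w' w' + b * ip w' w')) => t.
have := gmin _ (dom_lincomb 1 t Dg Dw'); rewrite yosida_expand//; lra.
Qed.

(** The positive part of [v] has no more energy than [v] and, as f >= 0, is no farther from [f]. So
    it is a minimizer too, and [resolves_min] identifies it with [v]. *)
Lemma resolves_ge0 b f v : 0 < b -> f \in L2 -> (forall x, 0 <= f x) ->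
  resolves b f v -> \forall x \ae m, 0 <= v x.
Proof.
move=> b0 f2 f0 vP; have Dv := vP.1.
have [] := pos_part Dv; set w := fun x => _ => Dw aw.
have := resolves_min (ltW b0) f2 vP Dw.
have v2 := dom_L2 Dv; have w2 := dom_L2 Dw.
have Dwv := dom_lincomb 1 (-1) Dw Dv.
have : ip (lincomb 1 w (-1) f) (lincomb 1 w (-1) f) <= ip (lincomb 1 v (-1) f) (lincomb 1 v (-1) f).
  apply: Rintegral_le; [exact/L2_sqr/L2_lincomb|exact/L2_sqr/L2_lincomb|move=> x].
  rewrite /lincomb /w !mul1r !mulN1r; have := f0 x.
  by case: (leP (v x) 0) => h fx; nra.
have := df_ge0 df Dwv.
rewrite /yosida => a0 le1 E.
have /(inner_eq0 (dom_L2 Dwv)) h : ip (lincomb 1 w (-1) v) (lincomb 1 w (-1) v) <= 0.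
  have := inner_ge0 m (lincomb 1 w (-1) v); nra.
apply: filterS h => x /(_ Logic.I); rewrite /lincomb /= mul1r mulN1r => /eqP.
by rewrite subr_eq0 => /eqP <-; rewrite /w le_max lexx orbT.
Qed.

(** sqrt(u^2 + w^2) dominates every c u + e w with c^2 + e^2 = 1; by linearity and positivity [vr]
    dominates the same combinations of [vu] and [vw]. The coefficients used in the end are [u x] and
    [w x], which vary with the point, so one null set has to serve all (c, e). *)
Lemma resolves_plane b u w r vu vw vr : 0 < b ->
  u \in L2 -> w \in L2 -> r \in L2 ->
  r = (fun x => Num.sqrt (u x ^+ 2 + w x ^+ 2)) ->
  resolves b u vu -> resolves b w vw -> resolves b r vr ->
  ip vu u + ip vw w <= ip vr r.
Proof.
move=> b0 u2 w2 r2 rE hu hw hr.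
have r0 x : 0 <= r x by rewrite rE sqrtr_ge0.
have hc c e : \forall x \ae m, c * vu x + e * vw x <=
    Num.sqrt (c ^+ 2 + e ^+ 2) * vr x.
  have k2 : lincomb c u e w \in L2 by exact: L2_lincomb.
  have := resolves_lincomb (Num.sqrt (c ^+ 2 + e ^+ 2)) (-1) r2 k2 hr
    (resolves_lincomb c e u2 w2 hu hw).
  move=> /(resolves_ge0 b0) h.
  have {h} : \forall x \ae m, 0 <=
     lincomb (Num.sqrt (c ^+ 2 + e ^+ 2)) vr (-1) (lincomb c vu e vw) x.
    apply: h; first exact: L2_lincomb.
    move=> x; rewrite /lincomb mulN1r subr_ge0 rE; exact: plane_cs.
  by apply: filterS => x; rewrite /lincomb mulN1r subr_ge0.
have hae : \forall x \ae m, forall c e : R, c * vu x + e * vw x <=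
    Num.sqrt (c ^+ 2 + e ^+ 2) * vr x.
  have vr0 := resolves_ge0 b0 r2 r0 hr.
  have : \forall x \ae m, forall n : nat,
     if @unpickle (rat * rat)%type n is Some z then
        ratr z.1 * vu x + ratr z.2 * vw x <=
           Num.sqrt (ratr z.1 ^+ 2 + ratr z.2 ^+ 2) * vr x else true.
    apply/ae_foralln => n; case: (unpickle n) => [z|]; first exact: hc.
    exact: aeW.
  apply: filterS2 vr0 => x vr0 h; apply: rat_plane_cs => // c e.
  by have := h (pickle (c, e)); rewrite pickleK.
have u' := dom_L2 hu.1; have w' := dom_L2 hw.1; have r' := dom_L2 hr.1.
have -> : ip vu u + ip vw w = I (lincomb 1 (fun x => vu x * u x) 1 (fun x => vw x * w x)).
  by rewrite Rintegral_lincomb ?L2_mul// !mul1r.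
apply: ae_le_Rintegral; [by apply: integrable_lincomb; exact: L2_mul|exact: L2_mul|].
apply: filterS hae => x h; rewrite /lincomb !mul1r rE.
by have := h (u x) (w x); rewrite (mulrC (vu x)) (mulrC (vw x)) (mulrC (vr x)).
Qed.

(* With v(f) = b G_b f, a(r, r) is approximated by b ((r, r) - (v(r), r)), and *)
(* (v(r), r) >= (v(u), u) + (v(w), w) by resolves_plane: positivity of G_b     *)
(* gives v(r) >= c v(u) + e v(w) whenever c^2 + e^2 = 1.                       *)
Lemma sqrt_contraction u w : D u -> D w ->
  let r := fun x => Num.sqrt (u x ^+ 2 + w x ^+ 2) in
  D r /\ a r r <= a u u + a w w.
Proof.
move=> Du Dw r; have u2 := dom_L2 Du; have w2 := dom_L2 Dw.
have rr x : r x * r x = u x * u x + w x * w x.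
  by rewrite -!expr2 sqr_sqrtr// addr_ge0// sqr_ge0.
have mr : measurable_fun setT r.
  apply: measurableT_comp; first exact: continuous_measurable_fun (@sqrt_continuous R).
  by apply: measurable_funD; apply: measurable_funX; exact: dom_measurable.
have irr := integrable_lincomb 1 1 (L2_sqr u2) (L2_sqr w2).
have Err : (fun x => r x * r x) =
    lincomb 1 (fun x => u x * u x) 1 (fun x => w x * w x).
  by apply/funext => x; rewrite /lincomb rr !mul1r.
have r2 : r \in L2 by apply: measurable_L2 => //; rewrite Err.
have iprr : ip r r = ip u u + ip w w.
  by rewrite /inner_prod Err Rintegral_lincomb ?L2_sqr// !mul1r.
have Sn n : 1 <= (n.+1%:R : R) by rewrite ler1n.
have Sp n : 0 < (n.+1%:R : R) by rewrite ltr0n.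
have /choice[v vP] n : exists v, resolves n.+1%:R r v by exact: resolvent.
pose C := a u u + a w w.
have yC n : yosida n.+1%:R r (v n) <= C.
  have [vu vuP] := resolvent (Sn n) u2; have [vw vwP] := resolvent (Sn n) w2.
  have := resolves_plane (Sp n) u2 w2 r2 erefl vuP vwP (vP n).
  have z0 z : D z -> lincomb 1 z (-1) z = cst 0.
    by move=> _; apply/funext => x; rewrite /lincomb /=; ring.
  have low z vz : D z -> resolves n.+1%:R z vz ->
      n.+1%:R * (ip z z - ip vz z) <= a z z.
    move=> Dz vzP; have z2 := dom_L2 Dz.
    rewrite -(resolves_energy z2 vzP).
    have := resolves_min (ltW (Sp n)) z2 vzP Dz.
    have -> : yosida n.+1%:R z z = a z z.
      rewrite /yosida z0// (_ : ip _ _ = 0) ?mulr0 ?addr0//.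
      by rewrite /inner_prod; under eq_Rintegral do rewrite mulr0; rewrite /Rintegral integral0.
    have := df_ge0 df (dom_lincomb 1 (-1) Dz vzP.1).
    have := inner_ge0 m (lincomb 1 z (-1) vz) => i0.
    have := mulr_ge0 (ltW (Sp n)) i0; lra.
  have := low _ _ Du vuP; have := low _ _ Dw vwP.
  rewrite (resolves_energy r2 (vP n)) iprr /C => l1 l2 h.
  have := ler_wpM2l (ltW (Sp n)) h; lra.
have Dv n := (vP n).1.
(* The single bound [yC] controls both terms of [yosida]: the energies of [v n] are at most C, and
   the squared L^2 distance to [r] is at most C / (n+1). *)
apply: (form_lsc Dv r2).
- apply: (@cvg0_harmonic _ _ C) => n; first exact: inner_ge0.
  rewrite ler_pdivlMr// mulrC; apply: le_trans (yC n).
  by rewrite lerDr; exact: (df_ge0 df).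
- move=> n; apply: le_trans (yC n).
  by rewrite lerDl mulr_ge0// inner_ge0.
Qed.

Lemma abs_contraction u : D u ->
  D (fun x => `|u x|) /\ a (fun x => `|u x|) (fun x => `|u x|) <= a u u.
Proof.
move=> Du; have D0 := df_dom0 df; have [] := sqrt_contraction Du D0.
have -> : (fun x => Num.sqrt (u x ^+ 2 + cst 0 x ^+ 2)) = (fun x => `|u x|).
  by apply/funext => x; rewrite /= expr0n/= addr0 sqrtr_sqr.
suff -> : a (cst 0) (cst 0) = 0 by rewrite addr0.
have -> : cst 0 = lincomb 0 u 0 u by apply/funext => x; rewrite /lincomb /=; ring.
by rewrite (psd_quad form_psd)//; ring.
Qed.

(* form_lsc applied to the midpoints of v_ n and w. *)
Lemma strong_cvg (v_ : nat -> T -> R) w : (forall n, D (v_ n)) -> D w ->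
  (forall n, a (v_ n) (v_ n) <= a w w) ->
  ip (lincomb 1 (v_ n) (-1) w) (lincomb 1 (v_ n) (-1) w) @[n --> \oo] --> 0 ->
  a (lincomb 1 (v_ n) (-1) w) (lincomb 1 (v_ n) (-1) w) @[n --> \oo] --> 0.
Proof.
move=> Dv Dw av vw.
have Ddiff n := dom_lincomb 1 (-1) (Dv n) Dw.
have diff0 n := df_ge0 df (Ddiff n).
apply/cvg0P => // e e0; apply: contrapT => hN.
have /choice[k kP] N : exists n, (N <= n)%N /\
    e <= a (lincomb 1 (v_ n) (-1) w) (lincomb 1 (v_ n) (-1) w).
  apply: contrapT => h; apply: hN; exists N => n Nn.
  by rewrite ltNge; apply/negP => h1; apply: h; exists n.
pose z n := lincomb 2^-1 (v_ (k n)) 2^-1 w.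
have Dz n : D (z n) by exact: dom_lincomb.
have az n : a (z n) (z n) <= a w w - e / 4.
  have := psd_mid form_psd (Dv (k n)) Dw; rewrite -/(z n).
  have := (kP n).2; have := av (k n); lra.
have zw : ip (lincomb 1 (z n) (-1) w) (lincomb 1 (z n) (-1) w) @[n --> \oo] --> 0.
  apply/cvg0P => [n|t t0]; first exact: inner_ge0.
  have [N hN'] := (cvg0P (fun n => inner_ge0 m (lincomb 1 (v_ n) (-1) w))).1 vw t t0.
  exists N => n Nn.
  have -> : lincomb 1 (z n) (-1) w = lincomb 2^-1 (lincomb 1 (v_ (k n)) (-1) w) 0 w.
    by apply/funext => x; rewrite /z /lincomb; field.
  rewrite (psd_quad dom_inner_psd)//.
  have := hN' (k n) (leq_trans Nn (kP n).1).
  have := inner_ge0 m (lincomb 1 (v_ (k n)) (-1) w); lra.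
have [_] := form_lsc Dz (dom_L2 Dw) zw az; lra.
Qed.

End form.

(** * Duality between potentials and squares *)

(** With M the arithmetic mean, add ln y <= y - 1 at y = h/M and y = 1/M with weights t and 1 - t:
    the right sides cancel. The first inequality is strict because h is not 1. *)
Lemma powR_lt_amgm (R : realType) (h t : R) : 0 < h -> h != 1 -> 0 < t < 1 ->
  h `^ t < t * h + (1 - t).
Proof.
move=> h0 h1 /andP[t0 t1]; set M := t * h + (1 - t).
have M0 : 0 < M by rewrite /M ltr_wpDl// ?mulr_ge0 ?subr_gt0 ?ltW.
have ln_lt (y : R) : 0 < y -> ln y <= y - 1.
  by move=> y0; have := expR_ge1Dx (ln y); rewrite lnK ?posrE//; lra.
have hM : h / M != 1.
  apply/eqP => E; have hE : h = M by rewrite -[LHS](divfK (lt0r_neq0 M0)) E mul1r.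
  have : (1 - t) * (h - 1) = 0.
    have -> : (1 - t) * (h - 1) = h - M by rewrite /M; ring.
    by apply/eqP; rewrite subr_eq0; apply/eqP.
  move=> /eqP; rewrite mulf_eq0 !subr_eq0 (negbTE h1) orbF eq_sym.
  by rewrite lt_eqF.
have hM0 : 0 < h / M by rewrite divr_gt0.
have l1 : ln (h / M) < h / M - 1.
  have : ln (h / M) != 0 by rewrite ln_eq0// posrE.
  by move=> /expR_gt1Dx; rewrite lnK ?posrE//; lra.
have l2 := ln_lt M^-1 ltac:(by rewrite invr_gt0).
rewrite ln_div ?posrE// in l1; rewrite lnV ?posrE// in l2.
have : t * ln h < ln M.
  have E : t * (h / M - 1) + (1 - t) * (M^-1 - 1) = 0.
    have : t * (h / M) + (1 - t) * M^-1 = 1.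
      by rewrite mulrA -mulrDl -/M divff// gt_eqF.
    lra.
  have : t * (ln h - ln M) < t * (h / M - 1) by rewrite ltr_pM2l.
  have : (1 - t) * (- ln M) <= (1 - t) * (M^-1 - 1) by rewrite ler_pM2l ?subr_gt0.
  lra.
by rewrite /powR gt_eqF// -{2}(lnK (_ : M \in Num.pos)) ?posrE// ltr_expR.
Qed.

Section young.
Context {R : realType}.
Variables p q : R.
Hypotheses (p1 : 1 < p) (qE : q = p / (p - 1)).

Lemma conj_gt1 : 1 < q.
Proof. by rewrite qE ltr_pdivlMr ?subr_gt0// mul1r gtrBl. Qed.

Lemma conj_inv : p^-1 + q^-1 = 1.
Proof.
have h1 : p != 0 by rewrite gt_eqF// (lt_trans ltr01).
have h2 : p - 1 != 0 by rewrite gt_eqF// subr_gt0.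
by rewrite qE; field; rewrite h1 h2.
Qed.

Lemma conj_mul : (q - 1) * p = q.
Proof.
have h2 : p - 1 != 0 by rewrite gt_eqF// subr_gt0.
by rewrite qE; field; rewrite h2.
Qed.

Lemma young (x y : R) : 0 <= y -> x * y <= `|x| `^ p / p + y `^ q / q.
Proof.
move=> y0; have q1 := conj_gt1.
apply: (@le_trans _ _ (`|x| * y)); first by rewrite ler_wpM2r// ler_norm.
by apply: conjugate_powR => //; [exact: lt_trans ltr01 _|exact: lt_trans ltr01 _|exact: conj_inv].
Qed.

(** Dividing x by the candidate y^(q-1) turns equality into r = r^p / p + 1/q with r > 0; strict
    AM-GM for r^p leaves only r = 1. For y = 0 both sides of the conclusion vanish because q > 1. *)
Lemma young_eq (x y : R) : 0 <= y -> x * y = `|x| `^ p / p + y `^ q / q ->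
  x = y `^ (q - 1).
Proof.
have q1 := conj_gt1; have p0 : 0 < p by exact: lt_trans ltr01 p1.
rewrite le_eqVlt => /predU1P[<-|y0 E].
  rewrite mulr0 powR0 ?gt_eqF ?(lt_trans _ q1)// mul0r addr0 => /esym/eqP.
  rewrite mulf_eq0 invr_eq0 (gt_eqF p0) orbF powR_eq0 normr_eq0 => /andP[/eqP -> _].
  by rewrite powR0// subr_eq0 gt_eqF.
pose z := y `^ (q - 1); have z0 : 0 < z by exact: powR_gt0.
pose r := x / z; have xE : x = r * z by rewrite /r divfK// gt_eqF.
have yq0 : 0 < y `^ q by exact: powR_gt0.
have yzE : z * y = y `^ q by rewrite mulrC mulr_powRB1// ?ltW// (lt_trans _ q1).
have zp : z `^ p = y `^ q by rewrite /z -powRrM conj_mul.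
have rE : r = `|r| `^ p / p + q^-1.
  apply: (mulIf (lt0r_neq0 yq0)); rewrite -{1}yzE mulrA -xE E.
  by rewrite xE normrM (gtr0_norm z0) powRM// ?ltW// zp; ring.
have q0 : 0 < q^-1 by rewrite invr_gt0 (lt_trans ltr01).
have r0 : 0 < r.
  by rewrite rE ltr_wpDl// divr_ge0 ?powR_ge0// ltW.
rewrite (gtr0_norm r0) in rE.
suff r1 : r = 1 by rewrite xE r1 mul1r.
have h0 : 0 < r `^ p by exact: powR_gt0.
have [h1|h1] := eqVneq (r `^ p) 1.
  by rewrite rE h1 mul1r conj_inv.
have t1 : 0 < p^-1 < 1 by rewrite invr_gt0 p0 invf_lt1.
have := powR_lt_amgm h0 h1 t1; rewrite -powRrM divff ?gt_eqF// powRr1 ?ltW//.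
have -> : 1 - p^-1 = q^-1 by apply/eqP; rewrite subr_eq -conj_inv addrC.
by rewrite mulrC -rE ltxx.
Qed.

End young.

Lemma sqr_powR (R : realType) (x s : R) : (x ^+ 2) `^ s = `|x| `^ (2 * s).
Proof. by rewrite powRrM powR_mulrn// real_normK// num_real. Qed.

Lemma powR_invl (R : realType) (x s : R) : 0 <= x -> x^-1 `^ s = x `^ (- s).
Proof. by move=> x0; rewrite -powR_inv1// -powRrM mulN1r. Qed.

Section potential_form.
Context d {T : measurableType d} {R : realType}.
Variable m : {measure set T -> \bar R}.
Implicit Types (f g u v w V : T -> R).
Local Notation int f := (m.-integrable setT (EFin \o f)).
Local Notation I f := (Rintegral m setT f).

Definition pform V u w := I (fun x => V x * u x * w x).

Definition pdom V := [set u | measurable_fun setT u /\ int (fun x => V x * u x * u x)].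

Section nonneg.
Variable V : T -> R.
Hypotheses (mV : measurable_fun setT V) (V0 : forall x, 0 <= V x).

Lemma pdom_mul u w : pdom V u -> pdom V w -> int (fun x => V x * u x * w x).
Proof.
move=> [mu ui] [mw wi]; have := integrable_lincomb 1 1 ui wi; apply: integrable_dominated.
  by do 2 apply: measurable_funM => //.
move=> x; rewrite /lincomb -mulrA normrM (ger0_norm (V0 x)).
have : `|u x * w x| <= u x * u x + w x * w x.
  rewrite ler_norml; have := sqr_ge0 (u x + w x); have := sqr_ge0 (u x - w x).
  rewrite !expr2; nra.
by move=> /(ler_wpM2l (V0 x)); lra.
Qed.

Lemma pform_psd : psd (pdom V) (pform V).
Proof.
split.
- move=> c e u v [mu ui] [mv vi]; split.
    by apply: measurable_funD; apply: measurable_funM.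
  have uv := pdom_mul (conj mu ui) (conj mv vi).
  have := integrable_lincomb 1 1 (integrable_lincomb (c ^+ 2) (c * e *+ 2) ui uv) (integrable_scale (e ^+ 2) vi).
  by apply: eq_integrable => // x _ /=; congr EFin; rewrite /lincomb; ring.
- move=> c e u v w Su Sv Sw; rewrite /pform -Rintegral_lincomb; try exact: pdom_mul.
  by congr (Rintegral _ _ _); apply/funext => x; rewrite /lincomb; ring.
- by move=> u v _ _; rewrite /pform; under eq_Rintegral do rewrite mulrAC.
- by move=> u _; apply: Rintegral_nonneg => x; rewrite -mulrA -expr2 mulr_ge0 ?sqr_ge0.
Qed.

End nonneg.
End potential_form.

Section pairing.
Context d {T : measurableType d} {R : realType}.
Variable m : {measure set T -> \bar R}.
Variables A p q : R.
Hypotheses (A0 : 0 < A) (p1 : 1 < p) (qE : q = p / (p - 1)).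
Implicit Types (f g u v w V : T -> R).
Local Notation int f := (m.-integrable setT (EFin \o f)).
Local Notation I f := (Rintegral m setT f).

Let q1 := conj_gt1 p1 qE.
Let p0 : 0 < p := lt_trans ltr01 p1.
Let q0 : 0 < q := lt_trans ltr01 q1.
Let pq := conj_inv p1 qE.

Definition pow2q u := fun x => `|u x| `^ (2 * q).
Local Notation pw := pow2q.
(* The norm of u^2 in L^q, that is the square of the norm of u in L^(2q). *)
Definition sqr_qnorm u : R := (I (pw u)) `^ q^-1.
Local Notation Nq := sqr_qnorm.
(** The extremal of Hoelder's inequality: the point of the ball B_A where W |-> int W u^2 is
    largest, when u is nonzero. *)
Definition qpotential u := fun x => A * Nq u `^ (1 - q) * `|u x| `^ (2 * (q - 1)).
Local Notation pot := qpotential.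

Lemma measurable_abs_powR f s : measurable_fun setT f ->
  measurable_fun setT (fun x => `|f x| `^ s).
Proof.
move=> mf; apply: (@measurableT_comp _ _ _ _ _ _ (@powR R ^~ s)) => //.
exact: measurableT_comp.
Qed.

Lemma pow2q_ge0 u x : 0 <= pw u x. Proof. exact: powR_ge0. Qed.
Lemma sqr_qnorm_ge0 u : 0 <= Nq u. Proof. exact: powR_ge0. Qed.

Lemma sqr_qnormK u : Nq u `^ q = I (pw u).
Proof.
by rewrite /Nq -powRrM mulVf ?gt_eqF// powRr1//; exact/Rintegral_nonneg/pow2q_ge0.
Qed.

Definition Lp_ball V := [/\ measurable_fun setT V, int (fun x => `|V x| `^ p) &
  I (fun x => `|V x| `^ p) <= A `^ p].

Lemma young_pair V u x : `|V x * u x ^+ 2| <= `|V x| `^ p / p + pw u x / q.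
Proof.
rewrite normrM (ger0_norm (sqr_ge0 _)); have := young p1 qE `|V x| (sqr_ge0 (u x)).
by rewrite normr_id sqr_powR.
Qed.

Lemma pairing_integrable V u : measurable_fun setT V -> measurable_fun setT u ->
  int (fun x => `|V x| `^ p) -> int (pw u) -> int (fun x => V x * u x ^+ 2).
Proof.
move=> mV mu iV iu; have := integrable_lincomb p^-1 q^-1 iV iu; apply: integrable_dominated.
  by apply: measurable_funM => //; exact: measurable_funX.
by move=> x; rewrite /lincomb [p^-1 * _]mulrC [q^-1 * _]mulrC; exact: young_pair.
Qed.

Lemma sqr_qnorm_eq0 u : int (pw u) -> Nq u = 0 -> u = cst 0 %[ae m].
Proof.
move=> ui /powR_eq0_eq0 N0.
have /(Rintegral_le0_ae_eq0 ui (pow2q_ge0 u)) h : I (pw u) <= 0 by rewrite N0.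
by apply: filterS h => x h /h /= /powR_eq0_eq0/normr0_eq0.
Qed.

(* Defect in Young's inequality for V / A and u^2 / ||u^2||_q; integrating it  *)
(* gives both Hoelder's inequality and its equality case.                      *)
Definition gap V u x := `|A^-1 * V x| `^ p / p + (u x ^+ 2 / Nq u) `^ q / q
    - (A^-1 * V x) * (u x ^+ 2 / Nq u).

Section gap.
Variables V u : T -> R.
Hypotheses (hV : Lp_ball V) (mu : measurable_fun setT u) (ui : int (pw u)).
Hypothesis (N0 : 0 < Nq u).

Lemma gap_ge0 x : 0 <= gap V u x.
Proof.
by rewrite subr_ge0; apply: young => //; rewrite divr_ge0 ?sqr_ge0 ?ltW.
Qed.

Lemma gapE : gap V u =
  lincomb 1 (lincomb ((A^-1) `^ p / p) (fun x => `|V x| `^ p) ((Nq u `^ q)^-1 / q) (pw u))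
    (- (A^-1 / Nq u)) (fun x => V x * u x ^+ 2).
Proof.
apply/funext => x; rewrite /gap /lincomb normrM (@ger0_norm _ A^-1) ?invr_ge0 ?ltW//.
rewrite (@powRM _ A^-1) ?invr_ge0 ?(ltW A0)// (@powRM _ (u x ^+ 2)) ?sqr_ge0 ?invr_ge0 ?(ltW N0)//.
rewrite sqr_powR -[(Nq u)^-1]powR_inv1 ?(ltW N0)// powRAC (powR_inv1 (powR_ge0 _ _)) -/(pw u x).
rewrite powR_inv1 ?(ltW N0)//; ring.
Qed.

Lemma gap_int : int (gap V u).
Proof.
have [mV iV _] := hV; rewrite gapE.
by apply: integrable_lincomb; [apply: integrable_lincomb|apply: pairing_integrable].
Qed.

(** After normalization the two power terms integrate to at most 1/p and to exactly 1/q, which add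
    up to 1. *)
Lemma gap_I : I (gap V u) <= 1 - A^-1 / Nq u * I (fun x => V x * u x ^+ 2).
Proof.
have [mV iV leV] := hV; rewrite gapE.
rewrite Rintegral_lincomb; [|by apply: integrable_lincomb|by apply: pairing_integrable].
rewrite Rintegral_lincomb// sqr_qnormK.
have E1 : (I (pw u))^-1 / q * I (pw u) = q^-1.
  rewrite mulrAC mulVf ?mul1r// -sqr_qnormK gt_eqF// powR_gt0//.
have E2 : A^-1 `^ p / p * I (fun x => `|V x| `^ p) <= p^-1.
  apply: (@le_trans _ _ (A^-1 `^ p / p * A `^ p)).
    by rewrite ler_wpM2l// divr_ge0 ?powR_ge0// ltW.
  by rewrite mulrAC -powRM ?invr_ge0 ?(ltW A0)// mulVf ?gt_eqF// powR1 mul1r.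
by rewrite E1 mul1r mulNr lerD2r; move: E2; rewrite -pq lerD2r.
Qed.

Lemma pairing_eq : I (fun x => V x * u x ^+ 2) = A * Nq u -> V = pot u %[ae m].
Proof.
move=> E; have : I (gap V u) <= 0.
  by apply: le_trans gap_I _; rewrite E mulrACA mulVf ?gt_eqF// mul1r mulVf ?gt_eqF//.
move=> /(Rintegral_le0_ae_eq0 gap_int gap_ge0); apply: filterS => x /[apply] /= /eqP.
rewrite subr_eq0 => /eqP/esym/(young_eq p1 qE) h.
have {}h := h (divr_ge0 (sqr_ge0 _) (ltW N0)).
apply: (mulfI (_ : A^-1 != 0)); first by rewrite invr_eq0 gt_eqF.
rewrite h /pot !mulrA mulVf ?gt_eqF// mul1r.
rewrite powRM ?sqr_ge0 ?invr_ge0 ?(ltW N0)// sqr_powR mulrC; congr (_ * _).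
by rewrite powR_invl ?opprB ?sqr_qnorm_ge0.
Qed.

End gap.

Lemma pairing_le V u : Lp_ball V -> measurable_fun setT u -> int (pw u) ->
  I (fun x => V x * u x ^+ 2) <= A * Nq u.
Proof.
move=> hV mu ui; have [mV _ _] := hV.
have [N0|N0] := eqVneq (Nq u) 0.
  rewrite N0 mulr0 (@ae_eq_Rintegral _ _ _ m _ (cst 0)); first by rewrite /Rintegral integral0.
  - by apply: measurable_funM => //; exact: measurable_funX.
  - exact: measurable_cst.
  - apply: filterS (sqr_qnorm_eq0 ui N0) => x h /h /= ->; rewrite expr0n mulr0//.
have {}N0 : 0 < Nq u by rewrite lt0r N0 sqr_qnorm_ge0.
have := le_trans (Rintegral_nonneg m (gap_ge0 V N0)) (gap_I hV mu ui N0).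
rewrite subr_ge0 -mulrA mulrC ler_pdivrMr// mul1r.
by rewrite mulrC ler_pdivrMr// mulrC.
Qed.

Section pot.
Variable u : T -> R.
Hypotheses (mu : measurable_fun setT u) (ui : int (pw u)).
Hypothesis (N0 : 0 < Nq u).

Lemma qpotential_ge0 x : 0 <= pot u x.
Proof. by rewrite !mulr_ge0 ?powR_ge0// ltW. Qed.

Lemma qpotential_measurable : measurable_fun setT (pot u).
Proof. by apply: measurable_funM => //; exact: measurable_abs_powR. Qed.

Lemma qpotential_powE : (fun x => `|pot u x| `^ p) =
  (fun x => (A `^ p * Nq u `^ (- q)) * pw u x).
Proof.
apply/funext => x; rewrite (ger0_norm (qpotential_ge0 x)) /pot.
rewrite !powRM ?mulr_ge0 ?powR_ge0 ?(ltW A0)// -!powRrM; congr (_ * _ `^ _ * _ `^ _).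
  by rewrite -opprB mulNr (conj_mul p1 qE).
by rewrite -mulrA (conj_mul p1 qE).
Qed.

Lemma qpotential_ball : Lp_ball (pot u).
Proof.
split; [exact: qpotential_measurable|by rewrite qpotential_powE; exact: integrable_scale|].
rewrite qpotential_powE Rintegral_scale// -sqr_qnormK -mulrA -powRD ?addNr ?powRr0 ?mulr1//.
by apply/implyP => _; rewrite gt_eqF.
Qed.

Lemma qpotential_sqrE : (fun x => pot u x * u x ^+ 2) =
  (fun x => (A * Nq u `^ (1 - q)) * pw u x).
Proof.
apply/funext => x; rewrite /pot /pw -mulrA; congr (_ * _).
rewrite -[u x ^+ 2]real_normK ?num_real// -powR_mulrn// -powRD.
  by congr (_ `^ _); ring.
by apply/implyP; rewrite gt_eqF// -[X in _ + X]mulr1 -mulrDr subrK mulr_gt0.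
Qed.

Lemma qpotential_pairing : I (fun x => pot u x * u x ^+ 2) = A * Nq u.
Proof.
rewrite qpotential_sqrE Rintegral_scale// -sqr_qnormK -mulrA -powRD; last by apply/implyP => _; rewrite gt_eqF.
by rewrite subrK powRr1// ltW.
Qed.

End pot.
End pairing.

(** Arithmetic of [minimizing_cauchy]: [x1], [x2], [x3] are squared L^2 distances, [x4] is the
    squared norm of the midpoint of two unit vectors, and [a1], [a2], [a3], [n1], [n2], [n3] are
    energies and norms of the two functions and their midpoint. The norms cancel by convexity,
    leaving 2 (r1 + r2) + (L + 1) x1. *)
Lemma cauchy_bound (R : realType)
    (A L e t x1 x2 x3 x4 a1 a2 a3 n1 n2 n3 r1 r2 : R) :
  0 < e -> 0 < A -> 0 <= L -> 0 <= x1 -> (L + 1) * (4 * t) = e / 4 ->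
  x1 <= 2 * x2 + 2 * x3 -> L * x4 <= a3 + A * n3 ->
  n3 <= 2^-1 * n1 + 2^-1 * n2 -> x1 = 2 * 1 + 2 * 1 - 4 * x4 ->
  a1 + A * n1 <= L + r1 -> a2 + A * n2 <= L + r2 ->
  x2 < t -> x3 < t -> r1 < e / 16 -> r2 < e / 16 ->
  2 * a1 + 2 * a2 - 4 * a3 + x1 < e.
Proof.
move=> e0 A0 L0 x10 tE h1 h2 h3 h4 h6 h7 h8 h9 h10 h11.
have h12 : A * n3 <= A * (2^-1 * n1 + 2^-1 * n2) by rewrite ler_wpM2l// ltW.
have L1 : 0 <= L + 1 by lra.
have x1t : x1 <= 4 * t by lra.
have h13 : (L + 1) * x1 <= (L + 1) * (4 * t) by exact: ler_wpM2l.
rewrite tE in h13; rewrite (_ : x4 = 1 - 4^-1 * x1) in h2; last by lra.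
lra.
Qed.

(** * Minimization of J *)

Section minimizer.
Context d {T : measurableType d} {R : realType}.
Variable m : {measure set T -> \bar R}.
Variables (D : set (T -> R)) (a : (T -> R) -> (T -> R) -> R).
Hypothesis df : dirichlet_form m D a.
Variables A p q : R.
Hypotheses (A0 : 0 < A) (p1 : 1 < p) (qE : q = p / (p - 1)).
Implicit Types (f g u v w V : T -> R).
Local Notation int f := (m.-integrable setT (EFin \o f)).
Local Notation I f := (Rintegral m setT f).
Local Notation ip := (inner_prod m).
Local Notation Nq := (sqr_qnorm m q).
Local Notation pw := (pow2q q).
Local Notation pot := (qpotential m A q).

Let q1 : 1 < q := conj_gt1 p1 qE.
Let q0 : 0 < q := lt_trans ltr01 q1.
Let qq0 : 0 < 2 * q. Proof. by rewrite mulr_gt0. Qed.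
Let qB0 : 0 < 2 * (q - 1). Proof. by rewrite mulr_gt0// subr_gt0. Qed.

Definition form_dom2q u := D u /\ int (pw u).
Local Notation DQ := form_dom2q.

Lemma pformE V u : pform m V u u = I (fun x => V x * u x ^+ 2).
Proof. by rewrite /pform; under eq_Rintegral do rewrite -mulrA -expr2. Qed.

Lemma powR_lincomb_le (c e x y s : R) : 0 <= s ->
  `|c * x + e * y| `^ s <=
  (2 * `|c|) `^ s * `|x| `^ s + (2 * `|e|) `^ s * `|y| `^ s.
Proof.
move=> s0; rewrite -!powRM ?mulr_ge0//.
have [h|h] := leP (`|e| * `|y|) (`|c| * `|x|).
- apply: (@le_trans _ _ ((2 * `|c| * `|x|) `^ s)); last by rewrite lerDl powR_ge0.
  apply: ge0_ler_powR; rewrite ?nnegrE ?mulr_ge0//.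
  by rewrite (le_trans (ler_normD _ _))// !normrM -mulrA mulr_natl mulr2n lerD2l.
- apply: (@le_trans _ _ ((2 * `|e| * `|y|) `^ s)); last by rewrite lerDr powR_ge0.
  apply: ge0_ler_powR; rewrite ?nnegrE ?mulr_ge0//.
  by rewrite (le_trans (ler_normD _ _))// !normrM -mulrA mulr_natl mulr2n lerD2r ltW.
Qed.

Lemma pow2q_integrable_lincomb c e u v : measurable_fun setT u -> measurable_fun setT v ->
  int (pw u) -> int (pw v) -> int (pw (lincomb c u e v)).
Proof.
move=> mu mv ui vi.
apply: integrable_dominated (integrable_lincomb ((2 * `|c|) `^ (2 * q)) ((2 * `|e|) `^ (2 * q)) ui vi).
  by apply: measurable_abs_powR; apply: measurable_funD; apply: measurable_funM.
by move=> x; rewrite ger0_norm ?powR_ge0//; apply: powR_lincomb_le; exact: ltW.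
Qed.

Lemma dom2q_lincomb c e u v : DQ u -> DQ v -> DQ (lincomb c u e v).
Proof.
move=> [Du ui] [Dv vi]; split; first exact: (dom_lincomb df).
by apply: pow2q_integrable_lincomb => //; exact: (dom_measurable df).
Qed.

Lemma pow2q_split u x : pw u x = `|u x| `^ (2 * (q - 1)) * u x ^+ 2.
Proof.
rewrite -[u x ^+ 2]real_normK ?num_real// -powR_mulrn// -powRD.
  by congr (_ `^ _); ring.
by apply/implyP; rewrite gt_eqF// -[X in _ + X]mulr1 -mulrDr subrK.
Qed.

Lemma pow2q_bounded u k : u \in Lfun m 2%:E -> (forall x, `|u x| <= k) -> int (pw u).
Proof.
move=> u2 uk; have mu := Lfun_measurable u2.
apply: integrable_dominated (integrable_scale (k `^ (2 * (q - 1))) (L2_sqr u2)).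
  exact: measurable_abs_powR.
move=> x; rewrite ger0_norm ?powR_ge0// pow2q_split -expr2.
rewrite ler_wpM2r ?sqr_ge0//; apply: ge0_ler_powR; rewrite ?nnegrE ?(ltW qB0)//.
by apply: le_trans (uk x).
Qed.

Lemma sqr_qnorm_le u v : int (pw u) -> int (pw v) -> (forall x, `|u x| <= `|v x|) ->
  Nq u <= Nq v.
Proof.
move=> ui vi uv; have q0' : 0 <= q^-1 by rewrite invr_ge0 ltW.
have nn z : I (pw z) \is Num.nneg by rewrite nnegrE; exact/Rintegral_nonneg/pow2q_ge0.
apply: (ge0_ler_powR q0' (nn u) (nn v)); apply: Rintegral_le ui vi _ => x.
by apply: (ge0_ler_powR (ltW qq0)) (uv x); rewrite nnegrE.
Qed.

Lemma sqr_qnorm_scale u c : int (pw u) -> Nq (lincomb c u 0 u) = c ^+ 2 * Nq u.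
Proof.
move=> ui; have E : pw (lincomb c u 0 u) = (fun x => `|c| `^ (2 * q) * pw u x).
  by apply/funext => x; rewrite /pw /lincomb mul0r addr0 normrM powRM.
rewrite /Nq E Rintegral_scale// powRM ?powR_ge0//; last exact/Rintegral_nonneg/pow2q_ge0.
by rewrite -powRrM mulfK ?gt_eqF// powR_mulrn// real_normK ?num_real.
Qed.

(** By duality the norm is a supremum of the convex functionals int W u^2 with W >= 0; testing with
    the extremal potential of the midpoint gives convexity. *)
Lemma sqr_qnorm_mid u v : measurable_fun setT u -> measurable_fun setT v ->
  int (pw u) -> int (pw v) ->
  Nq (lincomb 2^-1 u 2^-1 v) <= 2^-1 * Nq u + 2^-1 * Nq v.
Proof.
move=> mu mv ui vi; set w := lincomb _ _ _ _.
have mw : measurable_fun setT w.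
  by apply: measurable_funD; apply: measurable_funM.
have wi : int (pw w) by exact: pow2q_integrable_lincomb.
have [N0|N0] := eqVneq (Nq w) 0.
  by rewrite N0 addr_ge0// mulr_ge0// ?sqr_qnorm_ge0.
have {}N0 : 0 < Nq w by rewrite lt0r N0 sqr_qnorm_ge0.
have hV := qpotential_ball A0 p1 qE mw wi N0; have [mV iV _] := hV.
rewrite -(ler_pM2l A0) -(qpotential_pairing A p1 qE wi N0).
have iu := pairing_integrable p1 qE mV mu iV ui; have iv := pairing_integrable p1 qE mV mv iV vi.
apply: (@le_trans _ _ (I (lincomb 2^-1 (fun x => pot w x * u x ^+ 2)
                          2^-1 (fun x => pot w x * v x ^+ 2)))).
  apply: Rintegral_le; [exact: pairing_integrable iV wi|exact: integrable_lincomb|].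
  move=> x; rewrite [leRHS](_ : _ = pot w x * (2^-1 * u x ^+ 2 + 2^-1 * v x ^+ 2));
    last by rewrite /lincomb; ring.
  rewrite ler_wpM2l ?qpotential_ge0//.
  rewrite /w /lincomb !expr2; have := sqr_ge0 (u x - v x); rewrite expr2; lra.
rewrite Rintegral_lincomb//.
have hu := pairing_le A0 p1 qE hV mu ui; have hv := pairing_le A0 p1 qE hV mv vi.
apply: (@le_trans _ _ (2^-1 * (A * Nq u) + 2^-1 * (A * Nq v))).
  have h : 0 <= 2^-1 :> R by rewrite invr_ge0.
  exact: lerD (ler_wpM2l h hu) (ler_wpM2l h hv).
by move: (Nq u) (Nq v) => x y; rewrite mulrDr !(mulrCA A).
Qed.

(* J = J_num / ||.||_2^2 on the elements of D that lie in L^(2q); J is +oo on  *)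
(* the other nonzero elements of D.                                            *)
Definition J_num u : R := a u u + A * Nq u.
Local Notation F := J_num.

Lemma J_num_ge0 u : D u -> 0 <= F u.
Proof. by move=> Du; rewrite addr_ge0 ?(df_ge0 df)// mulr_ge0 ?sqr_qnorm_ge0 ?ltW. Qed.

Lemma J_num_scale c u : DQ u -> F (lincomb c u 0 u) = c ^+ 2 * F u.
Proof.
move=> [Du ui]; rewrite /F sqr_qnorm_scale// (psd_quad (form_psd df))//; ring.
Qed.

Definition inf_J : R := inf [set F u / ip u u | u in [set u | DQ u /\ 0 < ip u u]].
Local Notation Lam := inf_J.

Lemma inf_J_le u : DQ u -> Lam * ip u u <= F u.
Proof.
move=> uQ; have [i0|i0] := eqVneq (ip u u) 0.
  by rewrite i0 mulr0 J_num_ge0//; exact: uQ.1.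
have {}i0 : 0 < ip u u by rewrite lt0r i0 inner_ge0.
rewrite -ler_pdivlMr//; apply: ge_inf; last by exists u.
exists 0 => _ [v [[Dv _] v0] <-]; by rewrite divr_ge0 ?J_num_ge0// ltW.
Qed.

(** A bounded L^2 function lies in L^(2q), as |w|^(2q) <= k^(2(q-1)) w^2. These truncations carry
    statements from D and L^(2q) over to D. *)
Lemma dom2q_truncation u k : 0 < k -> D u ->
  let w := fun x => Num.min k `|u x| in
  DQ w /\ a w w <= a u u.
Proof.
move=> k0 Du w; have [Da aa] := abs_contraction df Du.
have [] := truncation df k0 Da.
have -> : (fun x => Num.min k (Num.max `|u x| 0)) = w.
  by apply/funext => x; rewrite max_l.
move=> Dw aw; split; last exact: le_trans aw aa.
split=> //; apply: (@pow2q_bounded _ k); first exact: (dom_L2 df).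
by move=> x; rewrite ger0_norm /w ?ge_min ?lexx// le_min normr_ge0 ltW.
Qed.

Lemma dom2q_nonzero u : D u -> 0 < ip u u -> exists2 w, DQ w & 0 < ip w w.
Proof.
move=> Du iu; have [wQ _] := dom2q_truncation ltr01 Du.
exists (fun x => Num.min 1 `|u x|) => //.
rewrite ltNge; apply/negP => /(inner_eq0 (dom_L2 df wQ.1)) h.
move: iu; rewrite (_ : ip u u = 0) ?ltxx//.
rewrite /inner_prod (@ae_eq_Rintegral _ _ _ m _ (cst 0)); first by rewrite /Rintegral integral0.
- by apply: measurable_funM; exact: (dom_measurable df).
- exact: measurable_cst.
- apply: filterS h => x /[apply] /=; case: leP => _; first by move/eqP; rewrite oner_eq0.
  by move=> /normr0_eq0 ->; rewrite mulr0.
Qed.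

Hypothesis nz : exists2 u, D u & 0 < ip u u.

Lemma inf_J_ge0 : 0 <= Lam.
Proof.
have [u Du iu] := nz; have [w wQ iw] := dom2q_nonzero Du iu.
apply: lb_le_inf; first by exists (F w / ip w w), w.
move=> _ [v [[Dv _] v0] <-]; by rewrite divr_ge0 ?J_num_ge0// ltW.
Qed.

Lemma almost_min (e : R) : 0 < e -> exists u, [/\ DQ u, ip u u = 1 & F u < Lam + e].
Proof.
move=> e0; have [u Du iu] := nz; have [w wQ iw] := dom2q_nonzero Du iu.
have [|_ [v [vQ iv] <-] h] := @inf_adherent _
    [set F u / ip u u | u in [set u | DQ u /\ 0 < ip u u]] e e0.
  split; first by exists (F w / ip w w), w.
  by exists 0 => _ [v [[Dv _] v0] <-]; rewrite divr_ge0 ?J_num_ge0// ltW.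
pose c := (Num.sqrt (ip v v))^-1.
have c2 : c ^+ 2 = (ip v v)^-1 by rewrite exprVn sqr_sqrtr// ltW.
exists (lincomb c v 0 v); split; first exact: dom2q_lincomb.
- rewrite (psd_quad (dom_inner_psd df)) ?c2; try exact: vQ.1.
  by rewrite mulVf ?gt_eqF//; ring.
- by rewrite J_num_scale// c2 mulrC.
Qed.

Hypothesis cpt : compact_embedding m D a.
Let Lam0 : 0 <= Lam := inf_J_ge0.

Lemma minimizing_sequence : exists (w : nat -> T -> R) f,
  [/\ forall n, DQ (w n), forall n, ip (w n) (w n) = 1,
      forall n, F (w n) <= Lam + n.+1%:R^-1, f \in Lfun m 2%:E &
      ip (lincomb 1 (w n) (-1) f) (lincomb 1 (w n) (-1) f) @[n --> \oo] --> 0].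
Proof.
have /choice[u uP] n : exists u, [/\ DQ u, ip u u = 1 & F u < Lam + n.+1%:R^-1].
  by apply: almost_min; rewrite invr_gt0.
have Du n : D (u n) by have [[]] := uP n.
(* The bound on the form norm: energy at most Lam + 1, squared L^2 norm equal to 1. *)
have [|phi [f [hphi f2 hf]]] := cpt (u_ := u) (C := Num.sqrt (Lam + 1 + 1)).
  move=> n; split=> //; rewrite /form_norm; apply: ler_wsqrtr.
  have [_ i1 Fn] := uP n.
  apply: lerD; last by rewrite -i1.
  apply: le_trans (ltW (lt_le_trans Fn _)).
    by rewrite lerDl mulr_ge0 ?sqr_qnorm_ge0 ?ltW.
  by rewrite lerD2l invf_le1 ?ler1n// ltr0n.
have phin n : (n <= phi n)%N.
  by elim: n => // n IH; apply: leq_ltn_trans IH _; exact: hphi.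
exists (u \o phi), f; split => //.
- by move=> n; have [] := uP (phi n).
- by move=> n; have [] := uP (phi n).
- move=> n; have [_ _ /ltW h] := uP (phi n); apply: le_trans h _.
  by rewrite lerD2l; exact: invS_le.
- by apply: inner_cvg0 => // n; exact: (dom_L2 df (Du _)).
Qed.

(** The midpoint of two almost-minimizers is bounded below by [inf_J_le] and its norm above by
    convexity. What is left is a multiple of the squared L^2 distance, small by L^2 convergence. *)
Lemma minimizing_cauchy (w : nat -> T -> R) f :
  (forall n, DQ (w n)) -> (forall n, ip (w n) (w n) = 1) ->
  (forall n, F (w n) <= Lam + n.+1%:R^-1) -> f \in Lfun m 2%:E ->
  ip (lincomb 1 (w n) (-1) f) (lincomb 1 (w n) (-1) f) @[n --> \oo] --> 0 ->
  form_cauchy m a w.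
Proof.
move=> wQ w1 wF f2 wf e e0.
have w2 n := dom_L2 df (wQ n).1.
pose t : R := e / (16 * (Lam + 1)).
have t0 : 0 < t by rewrite divr_gt0// mulr_gt0// ltr_wpDl.
have tE : (Lam + 1) * (4 * t) = e / 4.
  by rewrite /t; field; rewrite gt_eqF// ltr_wpDl.
have [N1 hN1] := (cvg0P (fun n => inner_ge0 m (lincomb 1 (w n) (-1) f))).1 wf t t0.
have [|N2 hN2] := @invS_lt R (e / 16); first by rewrite divr_gt0.
exists (maxn N1 N2) => i j; rewrite !geq_max => /andP[i1 i2] /andP[j1 j2].
have ij : lincomb 1 (w i) (-1) (w j) =
    lincomb 1 (lincomb 1 (w i) (-1) f) (-1) (lincomb 1 (w j) (-1) f).
  by apply/funext => x; rewrite /lincomb; ring.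
have h1 := psd_mid_le (inner_psd m) (L2_lincomb 1 (-1) (w2 i) f2) (L2_lincomb 1 (-1) (w2 j) f2).
rewrite -ij in h1.
have midQ := dom2q_lincomb 2^-1 2^-1 (wQ i) (wQ j).
have h2 := inf_J_le midQ.
have [[Di ui] [Dj uj]] := (wQ i, wQ j).
have h3 := sqr_qnorm_mid (dom_measurable df Di) (dom_measurable df Dj) ui uj.
have h4 := psd_mid (dom_inner_psd df) Di Dj.
have h5 := psd_mid (form_psd df) Di Dj.
rewrite !w1 in h4.
have h6 := wF i; have h7 := wF j; rewrite /J_num in h2 h6 h7.
have h8 := hN1 i i1; have h9 := hN1 j j1; have h10 := hN2 i i2; have h11 := hN2 j j2.
rewrite h5.
move: h1 h2 h3 h4 h6 h7 h8 h9 h10 h11.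
set r1 := i.+1%:R^-1; set r2 := j.+1%:R^-1.
set x1 := ip (lincomb 1 (w i) (-1) (w j)) _; set x2 := ip (lincomb 1 (w i) (-1) f) _.
set x3 := ip (lincomb 1 (w j) (-1) f) _; set x4 := ip (lincomb 2^-1 _ _ _) _.
set a1 := a (w i) (w i); set a2 := a (w j) (w j); set a3 := a (lincomb 2^-1 _ _ _) _.
set n1 := Nq (w i); set n2 := Nq (w j); set n3 := Nq _.
have x10 : 0 <= x1 by exact: inner_ge0.
move: x1 x2 x3 x4 a1 a2 a3 n1 n2 n3 r1 r2 x10 => x1 x2 x3 x4 a1 a2 a3 n1 n2 n3 r1 r2 x10.
by move=> h1 h2 h3 h4 h6 h7 h8 h9 h10 h11; exact: (cauchy_bound e0 A0 Lam0 x10 tE h1 h2 h3 h4 h6 h7 h8 h9 h10 h11).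
Qed.

Definition cut_off (k : R) g x := if `|g x| <= k then g x else 0.

Lemma measurable_cut_off k g : measurable_fun setT g -> measurable_fun setT (cut_off k g).
Proof.
move=> mg; apply: measurable_fun_ifT => //.
apply: measurable_fun_ler => //; exact: measurableT_comp.
Qed.

Lemma cut_off_le k g x : `|cut_off k g x| <= `|g x|.
Proof. by rewrite /cut_off; case: ifP; rewrite ?normr0. Qed.

Lemma cut_off_bound k g x : 0 <= k -> `|cut_off k g x| <= k.
Proof. by rewrite /cut_off; case: ifP; rewrite ?normr0. Qed.

Lemma cut_off_integrable k g : 0 <= k -> g \in Lfun m 2%:E -> int (pw (cut_off k g)).
Proof.
move=> k0 g2; have mg := Lfun_measurable g2.
apply: (pow2q_bounded (k := k)); last by move=> x; exact: cut_off_bound.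
apply: measurable_L2; first exact: measurable_cut_off.
apply: integrable_dominated (L2_sqr g2); first by apply: measurable_funM; exact: measurable_cut_off.
move=> x; rewrite normrM -[leRHS]ger0_norm; last by rewrite -expr2 sqr_ge0.
by rewrite normrM; apply: ler_pM => //; exact: cut_off_le.
Qed.

Section bounded_potential.
Variables (V : T -> R) (M : R).
Hypotheses (mV : measurable_fun setT V) (V0 : forall x, 0 <= V x).
Hypothesis VM : forall x, V x <= M.

Lemma pdom_bounded u : u \in Lfun m 2%:E -> pdom m V u.
Proof.
move=> u2; have mu := Lfun_measurable u2; split=> //.
apply: integrable_dominated (integrable_scale M (L2_sqr u2)); first by do 2 apply: measurable_funM => //.
move=> x; rewrite -mulrA ger0_norm; last by rewrite mulr_ge0// -expr2 sqr_ge0.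
by rewrite ler_wpM2r// -expr2 sqr_ge0.
Qed.

Lemma pform_bounded_cvg (w : nat -> T -> R) g :
  (forall n, w n \in Lfun m 2%:E) -> g \in Lfun m 2%:E ->
  ip (lincomb 1 (w n) (-1) g) (lincomb 1 (w n) (-1) g) @[n --> \oo] --> 0 ->
  pform m V (w n) (w n) @[n --> \oo] --> pform m V g g.
Proof.
move=> w2 g2 wg.
apply: (psd_cvg_diag (pform_psd m mV V0) (fun n => pdom_bounded (w2 n)) (pdom_bounded g2)).
have h := seq_cvgMr (k := M) wg; rewrite mulr0 in h.
apply: (squeeze_cvgr (f := cst 0) _ (cvg_cst 0) h).
apply: nearW => n; have d2 := L2_lincomb 1 (-1) (w2 n) g2.
have P := pdom_bounded d2.
rewrite (psd_ge0 (pform_psd m mV V0) P) andTb.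
rewrite -Rintegral_scale; last exact: L2_sqr.
apply: Rintegral_le; [by case: P|exact/integrable_scale/L2_sqr|].
by move=> x; rewrite -mulrA ler_wpM2r// -expr2 sqr_ge0.
Qed.

End bounded_potential.

(* The potential associated with cut_off k g is bounded, hence continuous for  *)
(* L^2 convergence; it bounds the norm of cut_off k g from below by duality.   *)
Lemma limit_cut_bound (w : nat -> T -> R) g k :
  (forall n, DQ (w n)) -> (forall n, F (w n) <= Lam + n.+1%:R^-1) -> D g ->
  a (lincomb 1 (w n) (-1) g) (lincomb 1 (w n) (-1) g) @[n --> \oo] --> 0 ->
  ip (lincomb 1 (w n) (-1) g) (lincomb 1 (w n) (-1) g) @[n --> \oo] --> 0 ->
  0 <= k -> a g g + A * Nq (cut_off k g) <= Lam.
Proof.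
move=> wQ wF Dg awg iwg k0.
have Dw n : D (w n) := (wQ n).1.
have w2 n := dom_L2 df (Dw n); have g2 := dom_L2 df Dg; have mg := dom_measurable df Dg.
have ag := psd_cvg_diag (form_psd df) Dw Dg awg.
have ci := cut_off_integrable k0 g2; have mc := measurable_cut_off k mg.
have [N0|N0] := eqVneq (Nq (cut_off k g)) 0.
  rewrite N0 mulr0 addr0.
  apply: (seq_cvg_le ag (cvg_harmonic_shift (C := Lam))) => n.
  by apply: le_trans (wF n); rewrite lerDl mulr_ge0 ?sqr_qnorm_ge0 ?ltW.
have {}N0 : 0 < Nq (cut_off k g) by rewrite lt0r N0 sqr_qnorm_ge0.
pose V := pot (cut_off k g).
have hV := qpotential_ball A0 p1 qE mc ci N0; have [mV iV _] := hV.
have V0 x : 0 <= V x by exact: qpotential_ge0.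
pose M := A * Nq (cut_off k g) `^ (1 - q) * k `^ (2 * (q - 1)).
have VM x : V x <= M.
  rewrite /V /pot /M ler_wpM2l ?mulr_ge0 ?powR_ge0 ?(ltW A0)//.
  by apply: ge0_ler_powR; rewrite ?(ltW qB0) ?nnegrE ?cut_off_bound.
have c1 := pform_bounded_cvg mV V0 VM w2 g2 iwg.
have c2 := seq_cvgD ag c1.
have : a g g + pform m V g g <= Lam.
  apply: (seq_cvg_le c2 (cvg_harmonic_shift (C := Lam))) => n.
  apply: le_trans (wF n); rewrite lerD2l pformE.
  by apply: (pairing_le A0 p1 qE hV) (wQ n).2; exact: (dom_measurable df).
apply: le_trans; rewrite lerD2l -(qpotential_pairing A p1 qE ci N0) -/V.
have [_ gi] := pdom_bounded mV V0 VM g2.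
rewrite -pformE; apply: Rintegral_le => //.
  have := pairing_integrable p1 qE mV mc iV ci.
  by apply: eq_integrable => // x _ /=; congr EFin; rewrite expr2 mulrA.
move=> x; rewrite -mulrA -[leRHS]mulrA ler_wpM2l//.
rewrite /cut_off; case: ifP => // _; rewrite mul0r -expr2; exact: sqr_ge0.
Qed.

(** The limit [g] in form norm satisfies the bound of [limit_cut_bound] at every level k. Fatou's
    lemma along k = n puts [g] in L^(2q) with J_num g <= Lam, and |g| has no more energy. *)
Lemma exists_minimizer : exists u,
  [/\ DQ u, forall x, 0 <= u x, ip u u = 1 & F u = Lam].
Proof.
have [w [f [wQ w1 wF f2 wf]]] := minimizing_sequence.
have Dw n : D (w n) := (wQ n).1.
have [g Dg [awg iwg]] := form_complete df Dw
  (minimizing_cauchy wQ w1 wF f2 wf).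
have g2 := dom_L2 df Dg; have mg := dom_measurable df Dg.
have ig : ip g g = 1.
  have := psd_cvg_diag (dom_inner_psd df) Dw Dg iwg.
  rewrite (_ : (fun n => _) = cst 1); last exact/funext.
  by move=> h; apply/esym; exact: (cvg_unique _ (cvg_cst _) h).
have bound k : 0 <= k -> a g g + A * Nq (cut_off k g) <= Lam.
  exact: limit_cut_bound wQ wF Dg awg iwg.
pose C := (Lam - a g g) / A.
have C0 k : 0 <= k -> Nq (cut_off k g) <= C.
  by move=> /bound h; rewrite /C ler_pdivlMr// mulrC lerBrDl.
have C00 : 0 <= C by apply: le_trans (C0 0 (lexx 0)); exact: sqr_qnorm_ge0.
have [gi Ig] : int (pw g) /\ I (pw g) <= C `^ q.
  apply: (@Rintegral_fatou _ _ _ m (fun n => pw (cut_off n%:R g))).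
  - exact: measurable_abs_powR.
  - by move=> n x; exact: pow2q_ge0.
  - by move=> x; exact: pow2q_ge0.
  - move=> x; apply: cvg_near_cst.
    exists (Num.bound `|g x|) => // n /= hn.
    rewrite /pw /cut_off ifT//; apply: le_trans (ltW (archi_boundP (normr_ge0 _))) _.
    by rewrite ler_nat.
  - by move=> n; exact: cut_off_integrable.
  - move=> n; rewrite -(sqr_qnormK _ p1 qE).
    by apply: ge0_ler_powR; rewrite ?nnegrE ?sqr_qnorm_ge0 ?(ltW q0) ?C0.
have Ng : Nq g <= C.
  rewrite -[leRHS]powRr1// -(mulfV (lt0r_neq0 q0)) powRrM.
  apply: ge0_ler_powR; rewrite ?nnegrE ?invr_ge0 ?(ltW q0) ?powR_ge0//.
  exact/Rintegral_nonneg/pow2q_ge0.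
have Fg : F g <= Lam.
  by move: Ng; rewrite /J_num /C ler_pdivlMr// lerBrDl mulrC.
pose u x := `|g x|.
have [Du au] := abs_contraction df Dg.
have Eu : pw u = pw g by apply/funext => x; rewrite /pw /u normr_id.
have uQ : DQ u by split; rewrite ?Eu.
have iu : ip u u = 1.
  rewrite -ig /inner_prod; congr (Rintegral _ _ _); apply/funext => x.
  by rewrite /u -!expr2 real_normK ?num_real.
exists u; split => //; [by move=> x; exact: normr_ge0|apply/eqP]; rewrite eq_le; apply/andP; split.
  by apply: le_trans Fg; rewrite /J_num /sqr_qnorm Eu lerD2r.
by have := inf_J_le uQ; rewrite iu mulr1.
Qed.

End minimizer.

(** * Extended-real norms, Rayleigh quotients and J in terms of real integrals *)

Section translation.
Context d {T : measurableType d} {R : realType}.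
Variable m : {measure set T -> \bar R}.
Variables (D : set (T -> R)) (a : (T -> R) -> (T -> R) -> R).
Hypothesis df : dirichlet_form m D a.
Variables A p q : R.
Hypotheses (A0 : 0 < A) (p1 : 1 < p) (qE : q = p / (p - 1)).
Implicit Types (f g u v w V W : T -> R).
Local Notation int f := (m.-integrable setT (EFin \o f)).
Local Notation I f := (Rintegral m setT f).
Local Notation ip := (inner_prod m).
Local Notation Nq := (sqr_qnorm m q).
Local Notation pw := (pow2q q).
Local Notation DQ := (form_dom2q m D q).
Local Notation F := (J_num m a A q).

Let q1 : 1 < q := conj_gt1 p1 qE.
Let q0 : 0 < q := lt_trans ltr01 q1.
Let p0 : 0 < p := lt_trans ltr01 p1.

Lemma Lball_Lp_ball W : Lball m p A W -> Lp_ball m A p W.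
Proof.
move=> [Wp NW]; have iW := Lfun_integrable (ltW p1) Wp.
split; [exact: Lfun_measurable Wp|exact: iW|].
move: NW; rewrite Lnorm_I// lee_fin => NW.
rewrite -[leLHS]powRr1; last by apply: Rintegral_nonneg => x; exact: powR_ge0.
rewrite -(mulVf (lt0r_neq0 p0)) powRrM.
by apply: ge0_ler_powR; rewrite ?nnegrE ?powR_ge0 ?(ltW p0) ?(ltW A0).
Qed.

Lemma Lp_ball_Lball W : Lp_ball m A p W -> Lball m p A W.
Proof.
move=> [mW iW IW]; split; first exact: Lfun_I.
rewrite Lnorm_I// lee_fin -[leRHS]powRr1 ?(ltW A0)// -(mulfV (lt0r_neq0 p0)) powRrM.
apply: ge0_ler_powR; rewrite ?nnegrE ?powR_ge0 ?invr_ge0 ?(ltW p0)//.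
by apply: Rintegral_nonneg => x; exact: powR_ge0.
Qed.

Lemma Lnorm_sqr u : int (pw u) ->
  'N[m]_q%:E[EFin \o (fun y => u y ^+ 2)%R]%E = (Nq u)%:E.
Proof.
move=> ui; have E : (fun x => `|u x ^+ 2| `^ q) = pw u.
  by apply/funext => x; rewrite ger0_norm ?sqr_ge0// sqr_powR.
by rewrite Lnorm_I ?E.
Qed.

Lemma Lnorm_2q u : int (pw u) ->
  ('N[m]_(2 * q)%:E[EFin \o u] ^+ 2)%E = (Nq u)%:E.
Proof.
move=> ui; rewrite Lnorm_I//; last by rewrite mulr_gt0.
rewrite -EFin_expe -powR_mulrn ?powR_ge0// -powRrM; congr ((_ `^ _)%:E).
by field; rewrite gt_eqF.
Qed.

Lemma Lnorm_2q_infty u : measurable_fun setT u -> ~ int (pw u) ->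
  ('N[m]_(2 * q)%:E[EFin \o u])%E = +oo%E.
Proof.
move=> mu nui; apply/eqP; rewrite -leye_eq leNgt; apply/negP => h; apply: nui.
have : u \in Lfun m (2 * q)%:E.
  by rewrite inE; apply/andP; split; rewrite inE.
have q2 : 1 <= 2 * q by apply: le_trans (ltW q1) _; rewrite ler_peMl ?(ltW q0) ?ler1n.
by move=> /(Lfun_integrable q2).
Qed.

Lemma Lnorm_2_sqr u : D u -> ('N[m]_2%:E[EFin \o u] ^+ 2)%E = (ip u u)%:E.
Proof.
by move=> Du; rewrite Lnorm_inner ?(dom_L2 df)// -EFin_expe sqr_sqrtr// inner_ge0.
Qed.

Lemma nonzero_ip u : D u -> nonzero m u <-> 0 < ip u u.
Proof.
move=> Du; have mu := dom_measurable df Du; split.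
  move=> nz; rewrite ltNge; apply/negP => h; apply: nz.
  exact: inner_eq0 (dom_L2 df Du) h.
move=> i0 nz; move: i0; rewrite (_ : ip u u = 0) ?ltxx//.
rewrite /inner_prod (@ae_eq_Rintegral _ _ _ m _ (cst 0)); first by rewrite /Rintegral integral0.
- exact: measurable_funM.
- exact: measurable_cst.
- by apply: filterS nz => x /[apply] /= ->; rewrite mulr0.
Qed.

Lemma J_fin u : DQ u -> 0 < ip u u -> J m a A q u = (F u / ip u u)%:E.
Proof.
move=> [Du ui] i0; by rewrite /J Lnorm_2q// Lnorm_2_sqr// inver gt_eqF//.
Qed.

Lemma J_infty u : D u -> ~ int (pw u) -> 0 < ip u u -> J m a A q u = +oo%E.
Proof.
move=> Du ui i0; rewrite /J Lnorm_2q_infty//; last exact: (dom_measurable df).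
rewrite Lnorm_2_sqr// inver gt_eqF// expe2 mulyy gt0_muley ?lte_fin//.
by rewrite addey// gt0_mulye// lte_fin invr_gt0.
Qed.

Lemma ip_integral u : D u -> (\int[m]_x (u x ^+ 2)%:E)%E = (ip u u)%:E.
Proof.
move=> Du; rewrite /inner_prod EFin_Rintegral; last exact/L2_sqr/(dom_L2 df).
by apply: eq_integral => x _; rewrite expr2.
Qed.

Lemma rayleigh_fin V u : D u -> 0 < ip u u -> int (fun x => V x * u x ^+ 2) ->
  rayleigh m a V u = ((a u u + I (fun x => V x * u x ^+ 2)) / ip u u)%:E.
Proof.
move=> Du i0 ui; rewrite /rayleigh ip_integral// inver gt_eqF//.
by rewrite -EFin_Rintegral// -EFinD -EFinM.
Qed.

Lemma rayleigh_infty V u : D u -> 0 < ip u u -> measurable_fun setT V ->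
  (forall x, 0 <= V x) -> ~ int (fun x => V x * u x ^+ 2) ->
  rayleigh m a V u = +oo%E.
Proof.
move=> Du i0 mV V0 nui; rewrite /rayleigh ip_integral// inver gt_eqF//.
have -> : (\int[m]_x (V x * u x ^+ 2)%:E)%E = +oo%E.
  apply/eqP; rewrite -leye_eq leNgt; apply/negP => h; apply: nui.
  apply/integrableP; split.
    apply/measurable_EFinP; apply: measurable_funM => //.
    by apply: measurable_funX; exact: (dom_measurable df).
  rewrite (eq_integral (fun x => (V x * u x ^+ 2)%:E))// => x _.
  by rewrite gee0_abs// lee_fin mulr_ge0// sqr_ge0.
by rewrite addey// gt0_mulye// lte_fin invr_gt0.
Qed.

Lemma rayleigh_definedP V u : int (fun x => V x * u x ^+ 2) ->
  rayleigh_defined m V u.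
Proof. by move=> ui; exact: integrable_add_def ui. Qed.

(** An element of D closer to [f] than the norm of [f] cannot vanish. *)
Lemma dense_nonzero f : f \in Lfun m 2%:E -> 0 < ip f f ->
  exists2 u, D u & 0 < ip u u.
Proof.
move=> f2 i0; have s0 : 0 < Num.sqrt (ip f f) by rewrite sqrtr_gt0.
have [u Du hu] := df_dense df f2 s0.
exists u => //; rewrite lt0r inner_ge0 andbT; apply/negP => /eqP iu.
have u2 := dom_L2 df Du.
have E : (f \- u)%R = lincomb 1 f (-1) u.
  by apply/funext => x; rewrite /lincomb /= mul1r mulN1r.
move: hu; rewrite E Lnorm_inner; last exact: L2_lincomb.
rewrite lte_fin ltr_sqrt// (psd_quad (inner_psd m))//.
have := psd_cs (inner_psd m) f2 u2; rewrite iu mulr0 => fu.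
have /eqP : ip f u ^+ 2 = 0 by apply/eqP; rewrite eq_le fu sqr_ge0.
by rewrite sqrf_eq0 => /eqP ->; rewrite !mulr0 !addr0 expr1n mul1r ltxx.
Qed.

End translation.

(** * A nonzero element of L^2 *)

Section radon.
Context {R : realType} {X : ptopologicalType}.
Variable m : {measure set (borelType X) -> \bar R}.
Local Notation ip := (inner_prod m).

(** The indicator of a compact neighbourhood of [point]: its measure is finite by compactness and
    positive because the interior is open and nonempty. *)
Lemma exists_L2_nonzero : locally_compact [set: X] -> hausdorff_space X ->
  finite_on_compacts m -> full_support m ->
  exists2 f : borelType X -> R, f \in Lfun m 2%:E & 0 < ip f f.
Proof.
move=> hlc hX fin full.
have [K nK [cK clK]] : exists2 K : set X, nbhs (point : X) K & compact K /\ closed K.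
  have [K hK cK] := hlc point Logic.I; exists K => //.
  by apply: (@filterS _ (nbhs (point : X)) _ _ _ _ hK) => x; apply.
have mK : measurable (K : set (borelType X)).
  rewrite -[K]setCK; apply: measurableC; apply: sub_sigma_algebra.
  exact: closed_openC.
have mKy := fin K cK.
have K0 : (0 < m K)%E.
  have oK := open_interior (K : set X).
  have mo : measurable ((K : set X)° : set (borelType X)).
    exact: sub_sigma_algebra.
  apply: lt_le_trans (_ : (m (K : set X)° <= _)%E); last first.
    by apply: le_measure; rewrite ?inE//; exact: interior_subset.
  by apply: full => //; exists point.
have fK : m K \is a fin_num by rewrite ge0_fin_numE.
have K1 : m.-integrable setT (EFin \o (\1_K : borelType X -> R)).
  apply/integrableP; split; first exact/measurable_EFinP.
  under eq_integral do rewrite gee0_abs ?lee_fin//.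
  by rewrite integral_indic// setIT.
have EK : (fun x => \1_K x * \1_K x) = \1_K :> (borelType X -> R).
  by apply/funext => x; rewrite indicE; case: (_ \in _); rewrite ?mulr1 ?mulr0.
exists (\1_K : borelType X -> R).
  by apply: measurable_L2; rewrite ?EK.
by rewrite /inner_prod EK -lte_fin EFin_Rintegral// integral_indic// setIT.
Qed.

End radon.

(** * Powers along sequences and the arithmetic of the variation *)

Lemma powR_seq_cvg (R : realType) (y : nat -> R) (l s : R) : 0 < s ->
  (forall n, 0 <= y n) -> y n @[n --> \oo] --> l ->
  y n `^ s @[n --> \oo] --> l `^ s.
Proof.
move=> s0 y0 yl.
have l0 : 0 <= l by exact: (seq_cvg_le (cvg_cst 0) yl).
move: l0; rewrite le_eqVlt => /predU1P[l0|l0].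
  rewrite -l0 powR0 ?gt_eqF//; rewrite -l0 in yl.
  apply/cvg0P => [n|e e0]; first exact: powR_ge0.
  have [N hN] := (cvg0P y0).1 yl (e `^ s^-1) (powR_gt0 _ e0).
  exists N => n /hN h; rewrite -[ltRHS]powRr1 ?ltW// -(mulVf (lt0r_neq0 s0)) powRrM.
  by apply: gt0_ltr_powR; rewrite ?nnegrE ?powR_ge0.
have hc : {for l, continuous (@powR R ^~ s)}.
  apply: differentiable_continuous; apply/derivable1_diffP.
  by apply: derivable_powR; rewrite in_itv /= l0.
exact: (cvg_comp _ _ yl hc).
Qed.

Lemma powR_le_neg (R : realType) (x y s : R) : 0 < x -> x <= y -> s <= 0 ->
  y `^ s <= x `^ s.
Proof.
move=> x0 xy s0; have y0 : 0 < y by exact: lt_le_trans xy.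
rewrite -[s]opprK [leLHS]powRN [leRHS]powRN lef_pV2 ?posrE ?powR_gt0//.
by apply: ge0_ler_powR; rewrite ?oppr_ge0// nnegrE ltW.
Qed.

(** The terms of order zero cancel because u attains [L]; the rest is divided by t. *)
Lemma variation_bound (R : realType) (t L i au aw ab N I1 I2 K : R) :
  0 < t -> au + N = L -> I1 <= N -> I2 <= K ->
  L * (1 + t * i) <= ab + (I1 + t * I2) -> ab <= au + t * aw ->
  L * i <= aw + K.
Proof.
move=> t0 FL h1 h2 h3 h4; rewrite -(ler_pM2l t0).
have : t * I2 <= t * K by rewrite ler_wpM2l// ltW.
nra.
Qed.

Lemma variation_zero (R : realType) (P B C : R) : P = 0 ->
  (forall t, 0 <= P + 2 * t * B + t ^+ 2 * C) -> B = 0.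
Proof.
by move=> P0 h; apply: (@quad_lin0 _ _ C) => t; have := h t; rewrite P0 add0r.
Qed.

(** * The minimizer as ground state *)

Section ground_state.
Context d {T : measurableType d} {R : realType}.
Variable m : {measure set T -> \bar R}.
Variables (D : set (T -> R)) (a : (T -> R) -> (T -> R) -> R).
Hypothesis df : dirichlet_form m D a.
Variables A p q : R.
Hypotheses (A0 : 0 < A) (p1 : 1 < p) (qE : q = p / (p - 1)).
Implicit Types (f g u v w V : T -> R).
Local Notation int f := (m.-integrable setT (EFin \o f)).
Local Notation I f := (Rintegral m setT f).
Local Notation ip := (inner_prod m).
Local Notation Nq := (sqr_qnorm m q).
Local Notation pw := (pow2q q).
Local Notation pot := (qpotential m A q).
Local Notation DQ := (form_dom2q m D q).
Local Notation F := (J_num m a A q).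
Local Notation Lam := (inf_J m D a A q).

Let q1 : 1 < q := conj_gt1 p1 qE.
Let q0 : 0 < q := lt_trans ltr01 q1.
Let qB0 : 0 < 2 * (q - 1). Proof. by rewrite mulr_gt0// subr_gt0. Qed.

Variable u : T -> R.
Hypotheses (uQ : DQ u) (u0 : forall x, 0 <= u x) (iu : ip u u = 1) (Fu : F u = Lam).

Lemma sqr_qnorm_gt0 : 0 < Nq u.
Proof.
rewrite lt0r sqr_qnorm_ge0 andbT; apply/negP => /eqP /(sqr_qnorm_eq0 uQ.2) h.
have : ip u u = 0; last by rewrite iu => /eqP; rewrite oner_eq0.
have mu := dom_measurable df uQ.1.
rewrite /inner_prod (@ae_eq_Rintegral _ _ _ m _ (cst 0)); first by rewrite /Rintegral integral0.
- exact: measurable_funM.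
- exact: measurable_cst.
- by apply: filterS h => x /[apply] /= ->; rewrite mulr0.
Qed.

(* sqrt(u^2 + t w^2) *)
Definition bump (w : T -> R) t x := Num.sqrt (u x ^+ 2 + (lincomb (Num.sqrt t) w 0 w x) ^+ 2).

Lemma bump_sqr w t x : 0 <= t -> bump w t x ^+ 2 = u x ^+ 2 + t * w x ^+ 2.
Proof.
move=> t0; rewrite sqr_sqrtr ?addr_ge0 ?sqr_ge0// /lincomb mul0r addr0 exprMn.
by rewrite sqr_sqrtr.
Qed.

Lemma bump_ge0 w t x : 0 <= bump w t x. Proof. exact: sqrtr_ge0. Qed.

Lemma bump_form w t : D w -> 0 <= t ->
  D (bump w t) /\ a (bump w t) (bump w t) <= a u u + t * a w w.
Proof.
move=> Dw t0; have Dsw := dom_lincomb df (Num.sqrt t) 0 Dw Dw.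
have [Db ab] := sqrt_contraction df uQ.1 Dsw; split=> //.
apply: le_trans ab _; rewrite (psd_quad (form_psd df))// sqr_sqrtr//.
by rewrite le_eqVlt; apply/orP; left; apply/eqP; ring.
Qed.

Lemma bump_le_abs w t x : `|bump w t x| <= `|lincomb 1 (fun x => `|u x|) (Num.sqrt t) (fun x => `|w x|) x|.
Proof.
have e0 : 0 <= lincomb 1 (fun x => `|u x|) (Num.sqrt t) (fun x => `|w x|) x.
  by rewrite /lincomb mul1r addr_ge0// mulr_ge0// sqrtr_ge0.
rewrite (ger0_norm e0) (ger0_norm (bump_ge0 _ _ _)) -[leRHS]ger0_norm//.
rewrite -sqrtr_sqr ler_wsqrtr// /lincomb mul0r addr0 mul1r sqrrD.
rewrite real_normK ?num_real// exprMn [in leRHS]exprMn real_normK ?num_real//.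
by rewrite addrAC lerDl mulrn_wge0// mulr_ge0// mulr_ge0// sqrtr_ge0.
Qed.

Lemma bump_int w t : DQ w -> 0 <= t -> int (pw (bump w t)).
Proof.
move=> [Dw wi] t0; have [Db _] := bump_form Dw t0.
have mu := dom_measurable df uQ.1; have mw := dom_measurable df Dw.
have ui' : int (pw (fun x => `|u x|)).
  by rewrite (_ : pw _ = pw u)//; [exact: uQ.2|apply/funext => x; rewrite /pow2q normr_id].
have wi' : int (pw (fun x => `|w x|)).
  by rewrite (_ : pw _ = pw w)//; apply/funext => x; rewrite /pow2q normr_id.
have mu' : measurable_fun setT (fun x => `|u x|) by exact: measurableT_comp.
have mw' : measurable_fun setT (fun x => `|w x|) by exact: measurableT_comp.
apply: integrable_dominated (pow2q_integrable_lincomb p1 qE 1 (Num.sqrt t) mu' mw' ui' wi').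
  by apply: measurable_abs_powR; exact: (dom_measurable df).
move=> x; rewrite ger0_norm ?pow2q_ge0//; apply: ge0_ler_powR; rewrite ?nnegrE//.
  by rewrite ltW// mulr_gt0.
exact: bump_le_abs.
Qed.

Lemma bump_ge w t x : 0 <= t -> `|u x| <= `|bump w t x|.
Proof.
move=> t0; rewrite (ger0_norm (bump_ge0 _ _ _)) -sqrtr_sqr ler_wsqrtr//.
by rewrite lerDl sqr_ge0.
Qed.

Lemma bump_mono w t t' x : 0 <= t <= t' -> `|bump w t x| <= `|bump w t' x|.
Proof.
move=> /andP[t0 tt']; rewrite !(ger0_norm (bump_ge0 _ _ _)).
rewrite -[leLHS]ger0_norm ?bump_ge0// -[leRHS]ger0_norm ?bump_ge0//.
rewrite -!sqrtr_sqr ler_wsqrtr// !bump_sqr//; last exact: le_trans tt'.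
by rewrite lerD2l ler_wpM2r// sqr_ge0.
Qed.

(** Up to a constant factor, w^2 times the potential of [bump w t]. For t in [0, 1] it is dominated
    by the fixed function [pw (bump w 1)]. *)
Definition bump_density w t x := `|bump w t x| `^ (2 * (q - 1)) * w x ^+ 2.

Lemma bump_density_le w t x : 0 <= t <= 1 -> `|bump_density w t x| <= pw (bump w 1) x.
Proof.
move=> t01; rewrite ger0_norm; last by rewrite mulr_ge0 ?powR_ge0// sqr_ge0.
rewrite (pow2q_split p1 qE) /bump_density.
apply: ler_pM; [exact: powR_ge0|exact: sqr_ge0| |].
- by apply: (ge0_ler_powR (ltW qB0)) (bump_mono w x t01); rewrite nnegrE.
- by rewrite bump_sqr// mul1r lerDr sqr_ge0.
Qed.

Lemma measurable_bump_density w t : D w -> 0 <= t ->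
  measurable_fun setT (bump_density w t).
Proof.
move=> Dw t0; have [Db _] := bump_form Dw t0.
apply: measurable_funM; first by apply: measurable_abs_powR; exact: (dom_measurable df).
by apply: measurable_funX; exact: (dom_measurable df).
Qed.

Lemma bump_density_int w t : DQ w -> 0 <= t <= 1 -> int (bump_density w t).
Proof.
move=> wQ t01; have /andP[t0 _] := t01.
apply: integrable_dominated (bump_int wQ ler01).
  by apply: measurable_bump_density => //; exact: wQ.1.
by move=> x; exact: bump_density_le.
Qed.

(** For r = [bump w t], the pairing of r^2 with the potential of r splits into a u^2 part, at most A
    ||u^2||_q by duality, and t times a w^2 part. Since ||r^2||_q >= ||u^2||_q and 1 - q < 0, the
    factor of that potential may be replaced by the one of u. *)
Lemma directional_t w t : DQ w -> 0 < t <= 1 ->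
  Lam * ip w w <= a w w + A * Nq u `^ (1 - q) * I (bump_density w t).
Proof.
move=> wQ /andP[t0 t1]; have tt1 : 0 <= t <= 1 by rewrite ltW.
have t0' := ltW t0; have Dw := wQ.1.
have [Db ab] := bump_form Dw t0'; have bi := bump_int wQ t0'.
have mb := dom_measurable df Db; have mu := dom_measurable df uQ.1; have mw := dom_measurable df Dw.
have NN : Nq u <= Nq (bump w t).
  by apply: (sqr_qnorm_le p1 qE) => //; [exact: uQ.2|move=> x; exact: bump_ge].
have Nb0 : 0 < Nq (bump w t) := lt_le_trans sqr_qnorm_gt0 NN.
have hV := qpotential_ball A0 p1 qE mb bi Nb0; have [mV iV _] := hV.
have iVu := pairing_integrable p1 qE mV mu iV uQ.2; have iVw := pairing_integrable p1 qE mV mw iV wQ.2.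
have e1 : A * Nq (bump w t) = I (fun x => pot (bump w t) x * u x ^+ 2) +
    t * I (fun x => pot (bump w t) x * w x ^+ 2).
  rewrite -(qpotential_pairing A p1 qE bi Nb0) -[X in X + _]mul1r -Rintegral_lincomb//.
  congr (Rintegral _ _ _); apply/funext => x; rewrite bump_sqr// /lincomb; ring.
have e2 : I (fun x => pot (bump w t) x * u x ^+ 2) <= A * Nq u.
  exact: (pairing_le A0 p1 qE hV mu uQ.2).
have e3 : I (fun x => pot (bump w t) x * w x ^+ 2) <=
    A * Nq u `^ (1 - q) * I (bump_density w t).
  rewrite -Rintegral_scale; last exact: bump_density_int.
  apply: Rintegral_le => //; first by apply: integrable_scale; exact: bump_density_int.
  move=> x; rewrite [leRHS]mulrA; apply: ler_wpM2r; first exact: sqr_ge0.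
  apply: ler_wpM2r; first exact: powR_ge0.
  apply: ler_wpM2l; first exact: ltW.
  have q1' : 1 - q <= 0 by rewrite subr_le0 ltW.
  exact: powR_le_neg sqr_qnorm_gt0 NN q1'.
have bQ : DQ (bump w t) by split.
have e4 := inf_J_le df A0 bQ.
have e5 : ip (bump w t) (bump w t) = 1 + t * ip w w.
  rewrite -iu -[X in X + _]mul1r -Rintegral_lincomb; [|exact/L2_sqr/(dom_L2 df)/uQ.1|exact/L2_sqr/(dom_L2 df)].
  congr (Rintegral _ _ _); apply/funext => x.
  by rewrite /lincomb mul1r -!expr2 bump_sqr.
rewrite e5 /J_num e1 in e4.
exact: (variation_bound t0 Fu e2 e3 e4 ab).
Qed.

Lemma bump_density0 w :
  bump_density w 0 = (fun x => `|u x| `^ (2 * (q - 1)) * w x ^+ 2).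
Proof.
apply/funext => x; rewrite /bump_density /bump /lincomb sqrtr0 !mul0r addr0.
by rewrite expr0n addr0 sqrtr_sqr normr_id.
Qed.

Lemma bump_cvg w x : `|bump w n.+1%:R^-1 x| @[n --> \oo] --> `|bump w 0 x|.
Proof.
rewrite (ger0_norm (bump_ge0 _ _ _)).
have h : (n.+1%:R^-1 : R) @[n --> \oo] --> (0 : R) by exact: cvg_harmonic.
have h2 : u x ^+ 2 + w x ^+ 2 * n.+1%:R^-1 @[n --> \oo] --> u x ^+ 2 + w x ^+ 2 * 0.
  by apply: seq_cvgD; [exact: cvg_cst|exact: seq_cvgMr].
apply: (seq_cvg_ext (cvg_comp _ _ h2 (@sqrt_continuous R _))) => [n|] /=.
  rewrite ger0_norm ?bump_ge0// -[LHS]ger0_norm ?bump_ge0// -sqrtr_sqr bump_sqr//.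
  by rewrite [w x ^+ 2 * _]mulrC.
by rewrite -[LHS]ger0_norm ?bump_ge0// -sqrtr_sqr bump_sqr// mul0r mulr0.
Qed.

Lemma directional w : DQ w -> Lam * ip w w <= a w w + pform m (pot u) w w.
Proof.
move=> wQ; have [Dw wi] := wQ.
have tn n : 0 < (n.+1%:R^-1 : R) <= 1 by rewrite invr_gt0 ltr0n invf_le1 ?ler1n ?ltr0n.
have tn' n : 0 <= (n.+1%:R^-1 : R) <= 1 by have /andP[/ltW -> ->] := tn n.
have t00 : 0 <= (0 : R) <= 1 by rewrite lexx ler01.
have cI : I (bump_density w n.+1%:R^-1) @[n --> \oo] --> I (bump_density w 0).
  apply: (@Rintegral_dominated_cvg _ _ _ m _ _ (pw (bump w 1))).
  - by move=> n; apply: measurable_bump_density => //; have /andP[] := tn' n.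
  - exact: measurable_bump_density.
  - move=> x; have h := @powR_seq_cvg _ _ _ (2 * (q - 1)) qB0 (fun n => normr_ge0 _) (bump_cvg (w := w) (x := x)).
    apply: (seq_cvg_ext (seq_cvgMr (k := w x ^+ 2) h)) => [n|]; exact: mulrC.
  - exact: bump_int.
  - by move=> n x; exact: bump_density_le.
have -> : pform m (pot u) w w = A * Nq u `^ (1 - q) * I (bump_density w 0).
  rewrite pformE -Rintegral_scale; last exact: bump_density_int.
  by congr (Rintegral _ _ _); apply/funext => x; rewrite bump_density0 mulrA.
have c2 := seq_cvgD (seq_cvg_cst (k := a w w)) (seq_cvgMr (k := A * Nq u `^ (1 - q)) cI).
apply: (seq_cvg_le (seq_cvg_cst (k := Lam * ip w w)) c2) => n.
exact: directional_t.
Qed.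

Local Notation V := (qpotential m A q u).

Let N0 : 0 < Nq u := sqr_qnorm_gt0.
Let mu : measurable_fun setT u := dom_measurable df uQ.1.
Let hV : Lp_ball m A p V := qpotential_ball A0 p1 qE mu uQ.2 N0.
Let mV : measurable_fun setT V. Proof. by case: hV. Qed.
Let V0 x : 0 <= V x. Proof. exact: qpotential_ge0. Qed.

Lemma dom2q_pdom w : DQ w -> pdom m V w.
Proof.
move=> [Dw wi]; split; first exact: (dom_measurable df).
have [_ iV _] := hV; have := pairing_integrable p1 qE mV (dom_measurable df Dw) iV wi.
by apply: eq_integrable => // x _ /=; rewrite expr2 mulrA.
Qed.

(** The truncations min(n+1, |w|) have energy and potential term at most those of [w], so only the
    L^2 norm has to converge. *)
Lemma lower_bound w : D w -> int (fun x => V x * w x ^+ 2) ->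
  Lam * ip w w <= a w w + I (fun x => V x * w x ^+ 2).
Proof.
move=> Dw wi; have [Da _] := abs_contraction df Dw.
pose w_ n x := Num.min n.+1%:R `|w x|.
have wQ n : DQ (w_ n) /\ a (w_ n) (w_ n) <= a w w by exact: (dom2q_truncation df p1 qE).
have ci := psd_cvg_diag (dom_inner_psd df) (fun n => (wQ n).1.1) Da
  (truncation_cvg (dom_L2 df Da) (fun x => normr_ge0 (w x))).
have -> : ip w w = ip (fun x => `|w x|) (fun x => `|w x|).
  by congr (Rintegral _ _ _); apply/funext => x; rewrite -!expr2 real_normK ?num_real.
apply: (seq_cvg_le (seq_cvgMr (k := Lam) ci) (cvg_cst _)) => n.
have [wnQ an] := wQ n.
apply: le_trans (directional wnQ) _.
rewrite pformE; apply: lerD => //; apply: Rintegral_le => //.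
  have [_ iV _] := hV; exact: (pairing_integrable p1 qE mV (dom_measurable df wnQ.1) iV wnQ.2).
move=> x; rewrite ler_wpM2l// -[leRHS]real_normK ?num_real// lerXn2r ?nnegrE//.
  by rewrite /w_ le_min normr_ge0 andbT ler0n.
by rewrite /w_ ge_min lexx orbT.
Qed.

Lemma energy_zero : a u u + pform m V u u - Lam * ip u u = 0.
Proof.
rewrite pformE (qpotential_pairing A p1 qE uQ.2 N0) iu mulr1.
by move: Fu; rewrite /J_num => ->; rewrite subrr.
Qed.

(** The form a + V - Lam is nonnegative along u + t w and zero at t = 0, so its linear coefficient
    vanishes. *)
Lemma weak_dom2q w : DQ w -> a u w + pform m V u w = Lam * ip u w.
Proof.
move=> wQ; have pu := dom2q_pdom uQ; have pw' := dom2q_pdom wQ.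
have h := @variation_zero _ (a u u + pform m V u u - Lam * ip u u)
  (a u w + pform m V u w - Lam * ip u w)
  (a w w + pform m V w w - Lam * ip w w) energy_zero.
apply/eqP; rewrite -subr_eq0; apply/eqP; apply: h => t.
have := directional (dom2q_lincomb df p1 qE 1 t uQ wQ).
rewrite (psd_quad (form_psd df) _ _ uQ.1 wQ.1) (psd_quad (dom_inner_psd df) _ _ uQ.1 wQ.1).
rewrite (psd_quad (pform_psd m mV V0) _ _ pu pw') -subr_ge0.
by congr (_ <= _); ring.
Qed.

(** The truncations of [w] converge to it in form norm ([strong_cvg]), so the equation passes to the
    limit in a and in the inner product. The equation itself bounds the potential term: Fatou's
    lemma gives integrability, then dominated convergence the limit. *)
Lemma weak_nonneg w : D w -> (forall x, 0 <= w x) ->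
  int (fun x => V x * u x * w x) /\ a u w + pform m V u w = Lam * ip u w.
Proof.
move=> Dw w0; have Du := uQ.1; have mw := dom_measurable df Dw.
pose w_ n x := Num.min n.+1%:R (w x).
have wabs n : w_ n = (fun x => Num.min n.+1%:R `|w x|).
  by apply/funext => x; rewrite ger0_norm.
have w_0 n x : 0 <= w_ n x by rewrite /w_ le_min w0 andbT.
have w_w n x : w_ n x <= w x by rewrite /w_ ge_min lexx orbT.
have wQ n : DQ (w_ n) /\ a (w_ n) (w_ n) <= a w w.
  by rewrite wabs; exact: (dom2q_truncation df p1 qE).
have Dw_ n := (wQ n).1.1.
have iw := truncation_cvg (dom_L2 df Dw) w0.
have aw := strong_cvg df Dw_ Dw (fun n => (wQ n).2) iw.
have ca := psd_cvg (form_psd df) Dw_ Dw aw Du.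
have ci := psd_cvg (dom_inner_psd df) Dw_ Dw iw Du.
have cV : pform m V u (w_ n) @[n --> \oo] --> Lam * ip u w - a u w.
  have h := seq_cvgB (seq_cvgMr (k := Lam) ci) ca.
  apply: (seq_cvg_ext h) => [n|].
    rewrite (psd_sym (dom_inner_psd df) (Dw_ n) Du) (psd_sym (form_psd df) (Dw_ n) Du).
    by rewrite -(weak_dom2q (wQ n).1) addrC addKr.
  by rewrite (psd_sym (dom_inner_psd df) Dw Du) (psd_sym (form_psd df) Dw Du).
have pdm n := pdom_mul mV V0 (dom2q_pdom uQ) (dom2q_pdom (wQ n).1).
have mVuw : measurable_fun setT (fun x => V x * u x * w x).
  by apply: measurable_funM => //; exact: measurable_funM.
have Vu0 x : 0 <= V x * u x by rewrite mulr_ge0.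
have pcv x : V x * u x * w_ n x @[n --> \oo] --> V x * u x * w x.
  apply: cvg_near_cst.
  exists (Num.bound (w x)) => // n /= hn; rewrite /w_ min_r//.
  apply: le_trans (ltW (archi_boundP (w0 x))) _.
  by rewrite ler_nat (leq_trans hn).
(* A crude bound uniform in n: -s <= 1 + s^2 for s = a(u, w_n), followed by Cauchy-Schwarz. *)
have bnd n : pform m V u (w_ n) <= Lam * ip u w + (1 + a u u * a w w).
  have E := weak_dom2q (wQ n).1.
  have L0 : 0 <= Lam by rewrite -Fu; exact: (J_num_ge0 df).
  have h1 : Lam * ip u (w_ n) <= Lam * ip u w.
    apply: ler_wpM2l => //; apply: Rintegral_le; [exact/L2_mul/(dom_L2 df)/Dw_/(dom_L2 df)|exact/L2_mul/(dom_L2 df)/Dw/(dom_L2 df)|].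
    by move=> x; rewrite ler_wpM2l.
  have h2 := psd_cs (form_psd df) Du (Dw_ n).
  have h3 : a u u * a (w_ n) (w_ n) <= a u u * a w w.
    by apply: ler_wpM2l (wQ n).2; exact: (df_ge0 df).
  have h4 : - a u (w_ n) <= 1 + a u (w_ n) ^+ 2.
    by rewrite -subr_ge0; have := sqr_ge0 (a u (w_ n) + 2^-1); nra.
  rewrite (_ : pform _ _ _ _ = Lam * ip u (w_ n) + - a u (w_ n)).
    apply: lerD => //; apply: le_trans h4 _; rewrite lerD2l.
    exact: le_trans h2 h3.
  by rewrite -E addrC addKr.
have [iVuw _] := Rintegral_fatou mVuw (fun n x => mulr_ge0 (Vu0 x) (w_0 n x))
   (fun x => mulr_ge0 (Vu0 x) (w0 x)) pcv pdm bnd.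
split=> //.
have cV2 : pform m V u (w_ n) @[n --> \oo] --> pform m V u w.
  apply: Rintegral_dominated_cvg iVuw _ => //.
  - by move=> n; exact: integrable_measurable (pdm n).
  - by move=> n x; rewrite ger0_norm ?ler_wpM2l// mulr_ge0.
by rewrite (cvg_unique _ cV2 cV)// addrC subrK.
Qed.

(** Both parts of w = max(w, 0) - max(-w, 0) lie in D and are covered by [weak_nonneg]. *)
Lemma weak_form w : D w ->
  int (fun x => V x * u x * w x) /\ a u w + pform m V u w = Lam * ip u w.
Proof.
move=> Dw; have Du := uQ.1; have u2 := dom_L2 df Du.
have [D1 _] := pos_part df Dw.
have [D2' _] := pos_part df (dom_lincomb df (-1) 0 Dw Dw).
set w1 := fun x => Num.max (w x) 0 in D1.
set w2 := fun x => Num.max _ 0 in D2'.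
have wE : w = lincomb 1 w1 (-1) w2.
  apply/funext => x; rewrite /lincomb /w1 /w2 /lincomb mul0r addr0 mul1r !mulN1r.
  by case: (leP (w x) 0) => h; [rewrite max_l ?oppr_ge0//|rewrite max_r ?oppr_le0 ?ltW//]; ring.
have [i1 e1] := weak_nonneg D1 (fun x => ltac:(by rewrite /w1 le_max lexx orbT)).
have [i2 e2] := weak_nonneg D2' (fun x => ltac:(by rewrite /w2 le_max lexx orbT)).
have E : (fun x => V x * u x * w x) =
    lincomb 1 (fun x => V x * u x * w1 x) (-1) (fun x => V x * u x * w2 x).
  by apply/funext => x; rewrite [in LHS]wE /lincomb; ring.
split; first by rewrite E; exact: integrable_lincomb.
have -> : pform m V u w = 1 * pform m V u w1 + (-1) * pform m V u w2.
  by rewrite [LHS]/pform E Rintegral_lincomb.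
rewrite wE (psd_linr (form_psd df))// (psd_linr (dom_inner_psd df))//; nra.
Qed.

Let iu0 : 0 < ip u u. Proof. by rewrite iu. Qed.

Lemma ball_int W : Lp_ball m A p W -> int (fun x => W x * u x ^+ 2).
Proof. by move=> [mW iW _]; exact: (pairing_integrable p1 qE mW mu iW uQ.2). Qed.

Lemma lambda1_le W : Lball m p A W ->
  (lambda1 m D a W <= (a u u + I (fun x => W x * u x ^+ 2))%:E)%E.
Proof.
move=> WL; have WP := Lball_Lp_ball A0 p1 WL; have iW := ball_int WP.
apply: ereal_inf_lbound; exists u.
  split; [exact: uQ.1|exact/(nonzero_ip df uQ.1)|exact: rayleigh_definedP].
by rewrite (rayleigh_fin df uQ.1 iu0 iW) iu divr1.
Qed.

Lemma lambda1_le_Lam W : Lball m p A W -> (lambda1 m D a W <= Lam%:E)%E.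
Proof.
move=> WL; apply: le_trans (lambda1_le WL) _; rewrite lee_fin -Fu /J_num lerD2l.
exact: (pairing_le A0 p1 qE (Lball_Lp_ball A0 p1 WL) mu uQ.2).
Qed.

(** Since V >= 0, a test function with V w^2 not integrable has quotient +oo; all others fall under
    [lower_bound]. *)
Lemma lambda1_qpotential : lambda1 m D a V = Lam%:E.
Proof.
apply/eqP; rewrite eq_le lambda1_le_Lam /=; last exact: Lp_ball_Lball.
apply: le_ereal_inf_tmp => _ [w [Dw /(nonzero_ip df Dw) iw _] <-].
have [wi|wi] := pselect (int (fun x => V x * w x ^+ 2)).
  rewrite (rayleigh_fin df Dw iw wi) lee_fin ler_pdivlMr//.
  exact: (lower_bound Dw wi).
by rewrite (rayleigh_infty df Dw iw mV V0 wi) leey.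
Qed.

Lemma rayleigh_qpotential : rayleigh m a V u = Lam%:E.
Proof.
rewrite (rayleigh_fin df uQ.1 iu0 (ball_int hV)) iu divr1.
by rewrite (qpotential_pairing A p1 qE uQ.2 N0) -Fu.
Qed.

Lemma J_min : J m a A q u = Lam%:E.
Proof. by rewrite (J_fin df A p1 qE uQ iu0) iu divr1 Fu. Qed.

Lemma J_ge w : D w -> nonzero m w -> (Lam%:E <= J m a A q w)%E.
Proof.
move=> Dw /(nonzero_ip df Dw) iw; have [wi|wi] := pselect (int (pw w)).
  have wQ : DQ w by split.
  rewrite (J_fin df A p1 qE wQ iw) lee_fin ler_pdivlMr//.
  exact: (inf_J_le df A0 wQ).
by rewrite (J_infty df A0 p1 qE Dw wi iw) leey.
Qed.

Lemma sup_lambda1 :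
  ereal_sup [set lambda1 m D a W | W in Lball m p A] = Lam%:E.
Proof.
apply/eqP; rewrite eq_le; apply/andP; split.
  by apply: ub_ereal_sup => _ [W WL <-]; exact: lambda1_le_Lam.
rewrite -lambda1_qpotential; apply: ereal_sup_ubound; exists V => //.
exact: Lp_ball_Lball.
Qed.

(** Testing lambda_1(W) with u gives int W u^2 >= A ||u^2||_q, hence equality in Hoelder's
    inequality, which determines W. *)
Lemma maximizer_unique W : Lball m p A W -> lambda1 m D a W = Lam%:E ->
  W = V %[ae m].
Proof.
move=> WL lW; have WP := Lball_Lp_ball A0 p1 WL.
have IW : I (fun x => W x * u x ^+ 2) = A * Nq u.
  have := lambda1_le WL; rewrite lW lee_fin -Fu /J_num lerD2l => h.
  by apply/eqP; rewrite eq_le h (pairing_le A0 p1 qE WP mu uQ.2).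
exact: (pairing_eq A0 p1 qE WP mu uQ.2 N0 IW).
Qed.

Lemma first_eigenfunction_qpotential : first_eigenfunction m D a V u.
Proof.
split; first exact/(nonzero_ip df uQ.1).
exists Lam; first exact: lambda1_qpotential.
split; first exact: uQ.1.
by move=> w Dw; exact: (weak_form Dw).
Qed.

End ground_state.

Theorem theorem1 (R : realType) (X : ptopologicalType)
    (m : {measure set (borelType X) -> \bar R})
    (D : set (borelType X -> R))
    (a : (borelType X -> R) -> (borelType X -> R) -> R)
    (A p q : R) :
  locally_compact [set: X] -> separable X -> hausdorff_space X ->
  finite_on_compacts m -> full_support m ->
  dirichlet_form m D a -> local_form m D a ->
  compact_embedding m D a -> has_cutoffs m D ->
  0 < A -> 1 < p -> q = p / (p - 1) ->
  exists u V : borelType X -> R,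
    [/\ extremal_pair m D a p A u V,
        forall W : borelType X -> R, Lball m p A W ->
          lambda1 m D a W =
            ereal_sup [set lambda1 m D a W' | W' in Lball m p A] ->
          W = V %[ae m] &
        [/\ D u /\ nonzero m u,
            forall w, D w -> nonzero m w -> (J m a A q u <= J m a A q w)%E,
            \forall x \ae m, 0 <= u x,
            first_eigenfunction m D a V u &
            [/\ V = (fun x => A *
                       fine ('N[m]_q%:E[EFin \o (fun y => u y ^+ 2)%R])%E `^ (1 - q)
                       * u x `^ (2 * (q - 1))) %[ae m],
                lambda1 m D a V = J m a A q u &
                J m a A q u = rayleigh m a V u]]].
Proof.
move=> hlc _ hX fin full df _ cpt _ A0 p1 qE.
have [f f2 if0] := exists_L2_nonzero hlc hX fin full.
have nz := dense_nonzero df f2 if0.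
have [u [uQ u0 iu Fu]] := exists_minimizer df A0 p1 qE nz cpt.
have supE := sup_lambda1 df A0 p1 qE uQ iu Fu.
have lamE := lambda1_qpotential df A0 p1 qE uQ iu Fu.
have JE := J_min df p1 qE uQ iu Fu.
have first := first_eigenfunction_qpotential df A0 p1 qE uQ u0 iu Fu.
exists u, (qpotential m A q u); split.
- split; rewrite ?supE ?lamE ?ltry//.
  apply: Lp_ball_Lball => //; apply: qpotential_ball => //.
  + exact: (dom_measurable df uQ.1).
  + exact: uQ.2.
  + exact: (sqr_qnorm_gt0 df uQ iu).
- move=> W WL; rewrite supE; exact: (maximizer_unique df A0 p1 qE uQ iu Fu).
split => //.
- by split; [exact: uQ.1|exact: first.1].
- by move=> w Dw nw; rewrite JE; exact: (J_ge df A0 p1 qE).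
- exact: aeW.
split.
(* [qpotential] is written with |u|, which is u because the minimizer is nonnegative at every
   point. *)
- apply: aeW => x _; rewrite (Lnorm_sqr p1 qE uQ.2) /qpotential ger0_norm//.
- by rewrite lamE JE.
- by rewrite JE (rayleigh_qpotential df A0 p1 qE uQ iu Fu).
Qed.
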